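(* There exist numerical positive constants $c_1,\dots,c_5$ such that the following holds for all $n\ge c_1$ and any $\alpha\in(0,1)$. Consider any two positive numbers $k_1\le k_2$ satisfying $$c_2\frac{n\log(2/\alpha)}{\log(n)}\Big[1+\log\Big(\frac{k_2}{k_1}\Big)\Big]\le k_2<n/2 .$$ For any multiple testing procedure $R$ such that $\mathrm{FDR}(P,R)\le c_3$ for any $P\in\mathcal P$ with $n_1(P)\le k_2$, there exists some $P\in\mathcal P$ with $n_1(P)\le k_1$ such that $$\mathbb P_{Y\sim P}(|R(Y)\cap\mathcal H_1(P)|=0)\ge2/5,$$ $$\mathbb P_{Y\sim P}\Big[|\mathrm{BH}^*_{\alpha/2}\cap\mathcal H_1(P)|\ge c_4\alpha^{-1}\Big\{\frac n{\log n}\Big\}^{1/2}\Big]\ge1-e^{-c_5\alpha^{-1}\{n/\log(n)\}^{1/2}}\ge4/5 .$$ In particular, $\mathbf I(R,k_2)\le c_3$ implies $\mathbf{II}(R,k_1,\alpha/2)\ge1/5$.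
   Context: Notation: $x\vee y=\max(x,y)$; $\overline\Phi$ is the upper tail function of $\mathcal N(0,1)$; a numerical constant is an absolute constant. Setting. One observes $Y=(Y_1,\dots,Y_n)$ with independent real coordinates, $Y_i\sim P_i$, and $P=\otimes_{i=1}^nP_i$ is the law of $Y$. $\mathcal P$ is the set of all such product distributions $P$ on $\mathbb R^n$ for which there exists $(\theta,\sigma)\in\mathbb R\times(0,\infty)$ with $|\{i: P_i=\mathcal N(\theta,\sigma^2)\}|>n/2$; this couple is unique and denoted $(\theta(P),\sigma(P))$. Let $\mathcal H_0(P)=\{i: P_i=\mathcal N(\theta(P),\sigma(P)^2)\}$ (true nulls), $\mathcal H_1(P)$ the complement of $\mathcal H_0(P)$ in $\{1,\dots,n\}$, $n_1(P)=|\mathcal H_1(P)|$. A multiple testing procedure is a measurable map $R$ from the data $Y$ to subsets $R(Y)\subset\{1,\dots,n\}$ (rejected hypotheses). Set $$\mathrm{FDP}(P,R(Y))=\frac{|R(Y)\cap\mathcal H_0(P)|}{|R(Y)|\vee1},\quad \mathrm{FDR}(P,R)=\mathbb E_{Y\sim P}[\mathrm{FDP}(P,R(Y))],\quad \mathrm{TDP}(P,R(Y))=\frac{|R(Y)\cap\mathcal H_1(P)|}{n_1(P)\vee1}.$$ BH. For $u\in\mathbb R$, $s>0$, let $p_i(u,s)=2\overline\Phi(|Y_i-u|/s)$, $T_\alpha(Y;u,s)=\max\{t\in[0,1]:\sum_{i=1}^n\mathbf 1\{p_i(u,s)\le t\}\ge nt/\alpha\}$ and $\mathrm{BH}_\alpha(Y;u,s)=\{i: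 p_i(u,s)\le T_\alpha(Y;u,s)\}$. The oracle BH procedure is $\mathrm{BH}^*_\alpha=\mathrm{BH}_\alpha(Y;\theta(P),\sigma(P))$. Risks, for real $k>0$: $\mathbf I(R,k)=\sup_{P\in\mathcal P,\,n_1(P)\le k}\mathrm{FDR}(P,R)$ and $\mathbf{II}(R,k,\alpha)=\sup_{P\in\mathcal P,\,n_1(P)\le k}\mathbb P_{Y\sim P}\big(\mathrm{TDP}(P,R)<\mathrm{TDP}(P,\mathrm{BH}^*_\alpha)\big)$. *)

(* Defs.v *)
From HB Require Import structures.
From mathcomp Require Import all_boot all_order all_algebra.
From mathcomp Require Import all_classical all_reals all_analysis.

Set Implicit Arguments.
Unset Strict Implicit.
Unset Printing Implicit Defensive.

Import Order.TTheory GRing.Theory Num.Theory.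
Import numFieldNormedType.Exports.

Local Open Scope classical_set_scope.
Local Open Scope ring_scope.

(* A family (P_i) of probability measures on the line together with its product
   measure on R^n, specified by its values on measurable rectangles; these
   determine it on the product sigma-algebra. *)
Record product_law (R : realType) (n : nat) := ProductLaw {
  margin : 'I_n -> probability R R ;
  law :> probability (n.-tuple R) R ;
  lawE : forall A : 'I_n -> set R, (forall i, measurable (A i)) ->
    law [set y | forall i, A i (tnth y i)]
    = (\big[*%E/1]_(i < n) margin i (A i))%E
}.

Section null_model.
Context {R : realType} {n : nat}.
Implicit Types (P : product_law R n) (y : n.-tuple R).
Implicit Types (rej : n.-tuple R -> {set 'I_n}) (S : {set 'I_n}).

(* A measure is a function on all sets, but its values on non-measurable sets
   carry no meaning: equality of laws is tested on Borel sets only. *)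
Definition gaussian_coords P (theta sigma : R) : {set 'I_n} :=
  [set i | `[< forall A : set R, measurable A ->
                 margin P i A = normal_prob theta sigma A >]].

Definition is_null P (ts : R * R) : Prop :=
  0 < ts.2 /\ n%:R / 2 < #|gaussian_coords P ts.1 ts.2|%:R :> R.

Definition has_null : set (product_law R n) :=
  [set P | exists ts : R * R, is_null P ts].

(* At most one couple satisfies [is_null P]; (0, 1) is only a default value
   outside [has_null]. *)
Definition null_param P : R * R := xget (0, 1) [set ts | is_null P ts].
Definition theta P : R := (null_param P).1.
Definition sigma P : R := (null_param P).2.

Definition H0 P : {set 'I_n} := gaussian_coords P (theta P) (sigma P).
Definition H1 P : {set 'I_n} := ~: H0 P.
Definition n1 P : nat := #|H1 P|.

(* Measurability with respect to the discrete sigma-algebra on subsets. *)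
Definition testing_procedure rej : Prop :=
  forall S, measurable [set y | rej y = S].

Definition FDP P S : R := #|S :&: H0 P|%:R / (maxn #|S| 1)%:R.
Definition TDP P S : R := #|S :&: H1 P|%:R / (maxn (n1 P) 1)%:R.

Definition FDR P rej : \bar R := 'E_P[fun y => FDP P (rej y)].

Definition normal_tail (x : R) : R := fine (normal_prob 0 1 `]x, +oo[).

Definition pvalue y (u s : R) (i : 'I_n) : R :=
  2 * normal_tail (`|tnth y i - u| / s).

Definition BH_levels (alpha : R) y (u s : R) : set R :=
  [set t | 0 <= t <= 1 /\
     n%:R * t / alpha <= \sum_(i < n) (pvalue y u s i <= t)%R%:R].

(* The supremum is a maximum, see [BH_threshold_max]. *)
Definition BH_threshold (alpha : R) y (u s : R) : R :=
  sup (BH_levels alpha y u s).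

Definition BH (alpha : R) y (u s : R) : {set 'I_n} :=
  [set i | pvalue y u s i <= BH_threshold alpha y u s].

Definition oracle_BH P (alpha : R) y : {set 'I_n} :=
  BH alpha y (theta P) (sigma P).

Definition sparse_class (k : R) : set (product_law R n) :=
  [set P | has_null P /\ (n1 P)%:R <= k].

Definition risk_I rej (k : R) : \bar R :=
  ereal_sup [set FDR P rej | P in sparse_class k].

Definition risk_II rej (k alpha : R) : \bar R :=
  ereal_sup [set P [set y | TDP P (rej y) < TDP P (oracle_BH P alpha y)]
            | P in sparse_class k].

Lemma BH_threshold_max (alpha : R) y (u s : R) : 0 < alpha ->
  BH_levels alpha y u s (BH_threshold alpha y u s) /\
  ubound (BH_levels alpha y u s) (BH_threshold alpha y u s).
Proof.
move=> a0; set L := BH_levels _ _ _ _; set T := BH_threshold _ _ _ _.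
have L0 : L 0.
  by split; rewrite ?lexx ?ler01// mulr0 mul0r sumr_ge0.
have hs : has_sup L by split; [exists 0 | exists 1 => t [/andP[]]].
have ubT : ubound L T by exact: sup_upper_bound.
split => //; split.
  rewrite (ubT _ L0)/=; apply: ge_sup; first by exists 0.
  by move=> t [/andP[]].
set N := \sum_(i < n) _.
have mono t : L t -> n%:R * t / alpha <= N.
  move=> Lt; case: (Lt) => _ /le_trans; apply.
  apply: ler_sum => i _; rewrite ler_nat.
  case: (lerP (pvalue y u s i) t) => // pt.
  by rewrite (le_trans pt)// ubT.
have [->|n0] := eqVneq (n%:R : R) 0.
  by rewrite mul0r mul0r sumr_ge0.
have np : (0 : R) < n%:R by rewrite lt_def n0 ler0n.
rewrite ler_pdivrMr// mulrC -ler_pdivlMr//.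
apply: ge_sup; first by exists 0.
by move=> t /mono; rewrite ler_pdivrMr// mulrC -ler_pdivlMr.
Qed.

End null_model.

(* Main.v *)
Require Import Defs.
From HB Require Import structures.
From mathcomp Require Import all_boot all_order all_algebra.
From mathcomp Require Import all_classical all_reals all_analysis.
From mathcomp Require Import measurable_realfun.
From mathcomp Require Import ring lra.

(** Two sparse Gaussian models can produce the same data while disagreeing on
    which observations are of interest, and no procedure can serve both.

    Let phi be the N(0, 1) density and let g be a multiple of the N(0, s^2)
    density, with s slightly above 1, that crosses phi at |x| = t ([tilt]). The
    identity phi + (g - phi)^+ = g + (phi - g)^+ describes one distribution in
    two ways ([mixture_pair_ex]): N(0, 1) nulls with a few alternatives in
    |x| > t, or N(0, s^2) nulls with more alternatives in |x| <= t. If the set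
    of alternatives is drawn at random, coordinate by coordinate, then the two
    mixtures of product laws are equal ([mixture_law_eq]).

    A rejected coordinate with |x| <= t is a false discovery in the first model,
    and one with |x| > t is a false discovery in the second. As soon as something
    is rejected the two false discovery proportions sum to at least 1, so control
    of the FDR in both models forces the procedure to be silent most of the time
    ([testing_tradeoff]). Hence it is silent with probability at least 2/5 for
    some fixed set of alternatives of the first model ([silent_alternative]).

    The oracle of the first model compares the data with N(0, 1). Beyond
    X = sqrt (ln n), the expected number of nulls is of order sqrt (n / ln n),
    whereas the alternatives are more numerous by a factor that
    the assumption on k2 makes as large as a constant over alpha ([design_ex]).
    The BH procedure at level alpha / 2 then rejects all of these alternatives
    ([BH_reject]), and there are enough of them except on an event of
    exponentially small probability ([oracle_power], [bern_lower_tail]). *)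

Set Implicit Arguments.
Unset Strict Implicit.
Unset Printing Implicit Defensive.

Import Order.TTheory GRing.Theory Num.Theory.
Import numFieldNormedType.Exports.

Local Open Scope classical_set_scope.
Local Open Scope ring_scope.

(** * Random subsets of coordinates *)

(** The law of a random subset of the coordinates that contains each [i]
    independently with probability [q i]. *)
Definition bern {R : realType} {n : nat} (q : 'I_n -> R) (S : {set 'I_n}) : R :=
  \prod_(i < n) (if i \in S then q i else 1 - q i).

Lemma sum_prod_set {R : realType} {n : nat} (a b : 'I_n -> R) :
  \sum_(S : {set 'I_n}) \prod_(i < n) (if i \in S then a i else b i) =
  \prod_(i < n) (a i + b i).
Proof. by rewrite bigA_distr. Qed.

Lemma bern_ge0 {R : realType} {n : nat} (q : 'I_n -> R) S :
  (forall i, 0 <= q i <= 1) -> 0 <= bern q S.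
Proof.
move=> q01; apply: prodr_ge0 => i _; have /andP[q0 q1] := q01 i.
by case: ifP => _ //; rewrite subr_ge0.
Qed.

Lemma sum_bern {R : realType} {n : nat} (q : 'I_n -> R) :
  \sum_(S : {set 'I_n}) bern q S = 1.
Proof.
rewrite sum_prod_set; apply: big1 => i _; rewrite addrC subrK//.
Qed.

Lemma sum_bern_mem {R : realType} {n : nat} (q : 'I_n -> R) (i : 'I_n) :
  \sum_(S : {set 'I_n} | i \in S) bern q S = q i.
Proof.
have -> : \sum_(S : {set 'I_n} | i \in S) bern q S =
  \sum_(S : {set 'I_n}) \prod_(j < n)
     (if j \in S then q j else if j == i then 0 else 1 - q j).
  rewrite big_mkcond/=; apply: eq_bigr => S _; case: ifPn => iS.
    apply: eq_bigr => j _; case: ifPn => // jS.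
    by case: eqVneq jS => // ->; rewrite iS.
  by rewrite (bigD1 i)//= (negbTE iS) eqxx mul0r.
rewrite sum_prod_set (bigD1 i)//= eqxx addr0 big1 ?mulr1// => j ji.
by rewrite (negbTE ji) addrC subrK.
Qed.

Lemma bern_mean {R : realType} {n : nat} (q : 'I_n -> R) :
  \sum_(S : {set 'I_n}) bern q S * #|S|%:R = \sum_(i < n) q i.
Proof.
under eq_bigr => S _ do rewrite -sum1_card natr_sum mulr_sumr big_mkcond/=.
rewrite exchange_big/=; apply: eq_bigr => i _.
rewrite -[RHS](sum_bern_mem q) [RHS]big_mkcond/=; apply: eq_bigr => S _.
by case: ifP; rewrite ?mulr1.
Qed.

Lemma bern_markov {R : realType} {n : nat} (q : 'I_n -> R) (k : R) :
  (forall i, 0 <= q i <= 1) -> 0 < k ->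
  \sum_(S : {set 'I_n} | k < #|S|%:R) bern q S <= (\sum_(i < n) q i) / k.
Proof.
move=> q01 k0; rewrite -bern_mean mulr_suml.
rewrite big_mkcond/=; apply: ler_sum => S _; case: ifPn => kS.
  rewrite -mulrA ler_peMr ?bern_ge0// ler_pdivlMr// mul1r ltW//.
by rewrite mulr_ge0 ?invr_ge0 ?(ltW k0)// mulr_ge0 ?bern_ge0.
Qed.

Lemma ln2_le1 {R : realType} : ln 2 <= 1 :> R.
Proof.
rewrite -[leRHS](expRK 1) ler_ln ?posrE ?expR_gt0//.
by apply: le_trans (expR_ge1Dx 1); rewrite -natr1.
Qed.

(** Chernoff's bound with E 2^(-|S|): if Q is the mean of |S|, this expectation
    is at most exp(-Q/2), and on the event 2^(-|S|) exceeds 2^(-Q/4). *)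
Lemma bern_lower_tail {R : realType} {n : nat} (q : 'I_n -> R) :
  (forall i, 0 <= q i <= 1) ->
  \sum_(S : {set 'I_n} | #|S|%:R < (\sum_(i < n) q i) / 4) bern q S <=
  expR (- ((\sum_(i < n) q i) / 4)).
Proof.
move=> q01; set Q := \sum_(i < n) q i.
have Q0 : 0 <= Q by apply: sumr_ge0 => i _; case/andP: (q01 i).
have l2 : 0 <= ln 2 :> R by apply: ln_ge0; rewrite ler1n.
pose z : R := 2^-1.
have zE : z = expR (- ln 2) by rewrite expRN lnK// posrE.
apply: (@le_trans _ _ (expR (ln 2 * (Q / 4)) *
    \sum_(S : {set 'I_n}) bern q S * z ^+ #|S|)).
  rewrite mulr_sumr big_mkcond/=; apply: ler_sum => S _; case: ifPn => SQ.
    rewrite mulrCA ler_peMr ?bern_ge0//.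
    rewrite zE -expRM_natl -expRD; apply: le_trans (expR_ge1Dx _).
    rewrite lerDl mulrN mulrC -mulrBl mulr_ge0// subr_ge0 ltW//.
  by rewrite !mulr_ge0 ?expR_ge0 ?bern_ge0// exprn_ge0// invr_ge0.
have -> : \sum_(S : {set 'I_n}) bern q S * z ^+ #|S| =
          \prod_(i < n) (q i * z + (1 - q i)).
  rewrite -sum_prod_set; apply: eq_bigr => S _.
  rewrite -prodr_const [X in _ * X]big_mkcond/= -big_split/=.
  by apply: eq_bigr => i _; case: ifP => //; rewrite mulr1.
apply: (@le_trans _ _ (expR (ln 2 * (Q / 4)) * expR (- (Q / 2)))).
  rewrite ler_wpM2l ?expR_ge0//.
  rewrite mulr_suml -sumrN expR_sum; apply: ler_prod => i _.
  have /andP[q0 q1] := q01 i.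
  apply/andP; split; first by rewrite /z; lra.
  by apply: le_trans (expR_ge1Dx _); rewrite /z; lra.
rewrite -expRD ler_expR.
have : ln 2 * (Q / 4) <= Q / 4 by rewrite ler_piMl ?ln2_le1// divr_ge0.
by lra.
Qed.

(** * Product laws and their mixtures *)

Definition box {R : realType} {n : nat} (A : 'I_n -> set R) : set (n.-tuple R) :=
  [set y | forall i, A i (tnth y i)].

Lemma measurable_box {R : realType} {n : nat} (A : 'I_n -> set R) :
  (forall i, measurable (A i)) -> measurable (box A).
Proof.
move=> mA; rewrite (_ : box A =
    \bigcap_(i in [set: 'I_n]) ((fun y : n.-tuple R => tnth y i) @^-1` A i)).
  apply: fin_bigcap_measurable => // i _.
  rewrite -[X in measurable X]setTI; exact: measurable_tnth.
by apply/seteqP; split=> y /= h i; [move=> _; exact: h|exact: (h i Logic.I)].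
Qed.

(** By induction on the number of coordinates: the image under consing of the
    product of the first margin with a law on shorter tuples. *)
Lemma product_law_ex {R : realType} {n : nat} (m : 'I_n -> probability R R) :
  exists P : product_law R n, margin P = m.
Proof.
suff [law lawP] : exists law : probability (n.-tuple R) R,
  forall A : 'I_n -> set R, (forall i, measurable (A i)) ->
    law (box A) = (\big[*%E/1]_(i < n) m i (A i))%E.
  by exists (ProductLaw lawP).
elim: n m => [|n IHn] m.
  exists \d_([tuple] : 0.-tuple R) => A _; rewrite big_ord0 /= diracE.
  by rewrite mem_set// => -[].
have [law lawP] := IHn (fun i => m (lift ord0 i)).
pose X (p : R * n.-tuple R) : n.+1.-tuple R := [the n.+1.-tuple R of p.1 :: p.2].
have mX : measurable_fun setT X by apply: measurable_cons.
exists (distribution (m ord0 \x law)%E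
          (mfun_Sub (mem_set mX) : {RV (m ord0 \x law)%E >-> n.+1.-tuple R})).
move=> A mA; rewrite /distribution /pushforward/=.
have -> : X @^-1` (box A) = A ord0 `*` box (fun i => A (lift ord0 i)).
  apply/seteqP; split=> -[x y] /=.
    move=> h; split; first exact: (h ord0).
    by move=> i; have := h (lift ord0 i); rewrite tnthS.
  move=> [h0 h] i; have [j ->|->] := unliftP ord0 i; last exact: h0.
  by rewrite tnthS; exact: h.
rewrite product_measure1E//; last exact: measurable_box.
rewrite big_ord_recl; congr (_ * _)%E; exact: lawP.
Qed.

(** Boxes are stable under intersection and generate the sigma-algebra. *)
Lemma tuple_measure_unique {R : realType} {n : nat}
    (m1 m2 : {measure set (n.-tuple R) -> \bar R}) :
  (m1 setT < +oo)%E ->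
  (forall A : 'I_n -> set R, (forall i, measurable (A i)) ->
     m1 (box A) = m2 (box A)) ->
  forall E, measurable E -> m1 E = m2 E.
Proof.
move=> fin eqbox E mE.
pose G : set (set (n.-tuple R)) :=
  [set B | exists2 A : 'I_n -> set R, (forall i, measurable (A i)) & B = box A].
have GT : G setT by exists (fun=> setT) => //; apply/seteqP; split.
apply: (@g_sigma_algebra_measure_unique _ _ _ G _ (fun=> setT)) => //.
- by move=> _ [A mA ->]; exact: measurable_box.
- by rewrite bigcup_const//; exists 0%N.
- move=> _ _ [A mA ->] [B mB ->]; exists (fun i => A i `&` B i).
    by move=> i; exact: measurableI.
  apply/seteqP; split=> y /=; first by move=> [h1 h2] i; split.
  by move=> h; split=> i; have [] := h i.
- by move=> _ [A mA ->]; exact: eqbox.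
move: E mE; apply: smallest_sub; first exact: smallest_sigma_algebra.
move=> B; rewrite -bigcup_seq => -[i _ [A mA <-]]; apply: sub_sigma_algebra.
exists (fun j => if j == i then A else setT); first by move=> j; case: ifP.
apply/seteqP; split=> y /=.
  by move=> [_ h] j; case: eqVneq => // ->.
by move=> /(_ i); rewrite eqxx; split.
Qed.

(** Uniqueness from boxes is a statement about measures, so a weighted sum of
    laws has to be recognised as one. *)
Lemma finite_mixture_ex {d} {T : measurableType d} {R : realType} {I : Type}
    (s : seq I) (w : I -> R) (P : I -> probability T R) :
  (forall i, 0 <= w i) ->
  exists m : {measure set T -> \bar R},
    forall A, m A = (\sum_(i <- s) (w i)%:E * P i A)%E.
Proof.
move=> w0; elim: s => [|i s [m mE]].
  by exists mzero => A; rewrite big_nil.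
exists (measure_add (mscale (NngNum (w0 i)) (P i)) m) => A.
rewrite big_cons -mE -[RHS]/(mscale (NngNum (w0 i)) (P i) A + m A)%E.
by rewrite -measure_addE.
Qed.

Lemma probability_fineK {d} {T : measurableType d} {R : realType}
    (P : probability T R) A :
  measurable A -> (fine (P A))%:E = P A.
Proof. by move=> mA; rewrite fineK// fin_num_measure. Qed.

Lemma fine_prob01 {d} {T : measurableType d} {R : realType}
    (P : probability T R) A :
  measurable A -> 0 <= fine (P A) <= 1.
Proof.
move=> mA; rewrite fine_ge0//= -lee_fin probability_fineK//; exact: probability_le1.
Qed.

Lemma law_box {R : realType} {n : nat} (P : product_law R n) (A : 'I_n -> set R) :
  (forall i, measurable (A i)) ->
  fine (P (box A)) = \prod_(i < n) fine (margin P i (A i)).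
Proof.
move=> mA; rewrite /box lawE//.
rewrite (eq_bigr (fun i => (fine (margin P i (A i)))%:E)); last first.
  by move=> i _; rewrite probability_fineK.
by rewrite prodEFin.
Qed.

(** Draw the set [S] of alternatives with the law [bern (fun=> p)], then the data
    from the product law with these alternatives. Expanding a product of sums
    over [S] ([sum_prod_set]) shows that a box has the product of the
    one-coordinate mixture probabilities, which are the same on both sides. *)
Lemma mixture_law_eq {R : realType} {n : nat} (p1 p2 : R)
    (nu1 f1 nu2 f2 : probability R R)
    (P1 P2 : {set 'I_n} -> product_law R n) :
  0 <= p1 <= 1 -> 0 <= p2 <= 1 ->
  (forall S i, margin (P1 S) i = if i \in S then f1 else nu1) ->
  (forall S i, margin (P2 S) i = if i \in S then f2 else nu2) ->
  (forall A, measurable A ->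
     p1 * fine (f1 A) + (1 - p1) * fine (nu1 A) =
     p2 * fine (f2 A) + (1 - p2) * fine (nu2 A)) ->
  forall E, measurable E ->
  \sum_(S : {set 'I_n}) bern (fun=> p1) S * fine (P1 S E) =
  \sum_(S : {set 'I_n}) bern (fun=> p2) S * fine (P2 S E).
Proof.
move=> p101 p201 M1 M2 eqm E mE.
have ex (p : R) (P : {set 'I_n} -> product_law R n) : 0 <= p <= 1 ->
    exists2 m : {measure set (n.-tuple R) -> \bar R},
      (m setT < +oo)%E &
      forall A, measurable A ->
        m A = (\sum_(S : {set 'I_n}) bern (fun=> p) S * fine (P S A))%:E.
  move=> p01; have [m mE'] := @finite_mixture_ex _ _ R _
    (index_enum {set 'I_n}) (bern (fun=> p)) (fun S => law (P S))
    (fun S => bern_ge0 S (fun=> p01)).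
  have mE2 A : measurable A ->
      m A = (\sum_(S : {set 'I_n}) bern (fun=> p) S * fine (P S A))%:E.
    move=> mA; rewrite mE' -sumEFin; apply: eq_bigr => S _.
    by rewrite EFinM probability_fineK.
  by exists m => //; rewrite mE2// ltry.
have rect (p : R) (nu f : probability R R) (P : {set 'I_n} -> product_law R n) A :
    (forall i, measurable (A i)) ->
    (forall S i, margin (P S) i = if i \in S then f else nu) ->
    \sum_(S : {set 'I_n}) bern (fun=> p) S * fine (P S (box A)) =
    \prod_(i < n) (p * fine (f (A i)) + (1 - p) * fine (nu (A i))).
  move=> mA M; rewrite -sum_prod_set; apply: eq_bigr => S _.
  rewrite law_box// /bern -big_split/=; apply: eq_bigr => i _.
  by rewrite M; case: ifP.
have [m1 fin1 m1E] := ex p1 P1 p101.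
have [m2 fin2 m2E] := ex p2 P2 p201.
have : m1 E = m2 E.
  apply: tuple_measure_unique => // A mA.
  have mb := measurable_box mA.
  rewrite m1E// m2E// (rect p1 nu1 f1 P1)// (rect p2 nu2 f2 P2)//.
  by congr EFin; apply: eq_bigr => i _; exact: eqm.
by rewrite m1E// m2E// => -[].
Qed.

(** * Statistics with finitely many values *)

Lemma expectation_finite_map {d} {T : measurableType d} {R : realType}
    (P : probability T R) {F : finType} (Z : T -> F) (g : F -> R) :
  (forall z, measurable [set y | Z y = z]) -> (forall z, 0 <= g z) ->
  ('E_P[fun y => g (Z y)] =
   (\sum_(z : F) g z * fine (P [set y | Z y = z]))%R%:E)%E.
Proof.
move=> mZ g0; rewrite unlock.
transitivity (\int[P]_y \sum_(z : F) ((g z)%:E * (\1_[set y | Z y = z] y)%:E)%E)%E.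
  apply: eq_integral => y _.
  rewrite (bigD1 (Z y))//= big1 ?adde0.
    by rewrite indicE mem_set//= mule1.
  by move=> z zZ; rewrite indicE memNset ?mule0//=; apply/eqP; rewrite eq_sym.
rewrite ge0_integral_sum//=; last 2 first.
- move=> z; apply: measurable_funeM; apply/measurable_EFinP.
  by apply: measurable_indic.
- by move=> z y _; rewrite mule_ge0// lee_fin.
rewrite -sumEFin; apply: eq_bigr => z _.
rewrite ge0_integralZl ?lee_fin//; last first.
  by apply/measurable_EFinP; apply: measurable_indic.
by rewrite integral_indic// setIT EFinM probability_fineK.
Qed.

Lemma measurable_finite_preimage {d} {T : measurableType d}
    {F : finType} (Z : T -> F) (D : set F) :
  (forall z, measurable [set y | Z y = z]) -> measurable [set y | D (Z y)].
Proof.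
move=> mZ; rewrite (_ : [set y | D (Z y)] = \bigcup_(z in D) [set y | Z y = z]).
  by apply: fin_bigcup_measurable => //; exact: finite_finset.
apply/seteqP; split=> y /=; first by move=> Dy; exists (Z y).
by move=> [z Dz ->].
Qed.

Lemma prob_finite_map {d} {T : measurableType d} {R : realType}
    (P : probability T R) {F : finType} (Z : T -> F) (D : pred F) :
  (forall z, measurable [set y | Z y = z]) ->
  fine (P [set y | D (Z y)]) = \sum_(z : F | D z) fine (P [set y | Z y = z]).
Proof.
move=> mZ.
have mD := measurable_finite_preimage D mZ.
apply: EFin_inj; rewrite probability_fineK// -(expectation_indic P mD).
transitivity ('E_P[fun y => (D (Z y))%:R])%E.
  congr expectation.body; apply/funext => y.
  by rewrite indicE; congr (_%:R); rewrite mem_setE.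
rewrite (expectation_finite_map P (g := fun z => (D z)%:R))//.
congr EFin; rewrite [RHS]big_mkcond/=; apply: eq_bigr => z _.
by case: (D z); rewrite ?mul1r ?mul0r.
Qed.

Definition hits {R : realType} {n : nat} (A : 'I_n -> set R) (y : n.-tuple R) :
  {set 'I_n} := [set i | `[< A i (tnth y i) >]].

Lemma hits_box {R : realType} {n : nat} (A : 'I_n -> set R) (U : {set 'I_n}) :
  [set y | hits A y = U] = box (fun i => if i \in U then A i else ~` A i).
Proof.
apply/seteqP; split=> y /=.
  move=> <- i; rewrite inE; case: asboolP => //.
move=> h; apply/setP => i; rewrite inE; have := h i.
by case: ifP => iU; case: asboolP.
Qed.

Lemma measurable_hits {R : realType} {n : nat} (A : 'I_n -> set R) (U : {set 'I_n}) :
  (forall i, measurable (A i)) -> measurable [set y | hits A y = U].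
Proof.
move=> mA; rewrite hits_box; apply: measurable_box => i.
by case: ifP => // _; exact: measurableC.
Qed.

(** Under a product law, whether [A i] holds at [i] is decided independently of
    the other coordinates. *)
Lemma law_hits {R : realType} {n : nat} (P : product_law R n)
    (A : 'I_n -> set R) (U : {set 'I_n}) :
  (forall i, measurable (A i)) ->
  fine (P [set y | hits A y = U]) = bern (fun i => fine (margin P i (A i))) U.
Proof.
move=> mA; rewrite hits_box law_box; last first.
  by move=> i; case: ifP => // _; exact: measurableC.
apply: eq_bigr => i _; case: ifP => // _.
by rewrite probability_setC// fineB// fin_num_measure.
Qed.

Lemma hits_lower_tail {R : realType} {n : nat} (P : product_law R n)
    (A : 'I_n -> set R) (Q : R) :
  (forall i, measurable (A i)) -> \sum_(i < n) fine (margin P i (A i)) = Q ->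
  fine (P [set y | #|hits A y|%:R < Q / 4]) <= expR (- (Q / 4)).
Proof.
move=> mA QE.
rewrite (prob_finite_map P (fun U : {set 'I_n} => #|U|%:R < Q / 4)); last first.
  by move=> U; exact: measurable_hits.
under eq_bigr => U _ do rewrite law_hits//.
by rewrite -QE; apply: bern_lower_tail => i; exact: fine_prob01.
Qed.

(** * Two models for the same data *)

(** What matters of the data when two models are compared: the rejections, and
    the observations that fall in [B]. The range is finite, so expectations are
    finite sums. *)
Definition cell {R : realType} {n : nat} (rej : n.-tuple R -> {set 'I_n})
    (B : set R) (y : n.-tuple R) : {set 'I_n} * {set 'I_n} :=
  (rej y, hits (fun=> B) y).

Lemma measurable_cell {R : realType} {n : nat}
    (rej : n.-tuple R -> {set 'I_n}) (B : set R) z :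
  testing_procedure rej -> measurable B ->
  measurable [set y | cell rej B y = z].
Proof.
move=> mrej mB; case: z => T C.
rewrite (_ : [set y | _] = [set y | rej y = T] `&` [set y | hits (fun=> B) y = C]).
  by apply: measurableI; [exact: mrej|exact: measurable_hits].
by apply/seteqP; split=> y; rewrite /cell/= => -[-> ->].
Qed.

(** The FDR when the alternatives are exactly [S] ([FDR_cell]). Naming [S]
    instead of using [H1 P] keeps the quantity meaningful for the sets [S],
    drawn with small probability, that leave no majority of nulls. *)
Definition cell_fdr {R : realType} {n : nat} (P : product_law R n)
    (rej : n.-tuple R -> {set 'I_n}) (B : set R) (S : {set 'I_n}) : R :=
  \sum_z #|z.1 :&: ~: S|%:R / (maxn #|z.1| 1)%:R
         * fine (P [set y | cell rej B y = z]).

Lemma FDR_cell {R : realType} {n : nat} (P : product_law R n)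
    (rej : n.-tuple R -> {set 'I_n}) (B : set R) (S : {set 'I_n}) :
  testing_procedure rej -> measurable B -> H0 P = ~: S ->
  FDR P rej = (cell_fdr P rej B S)%:E.
Proof.
move=> mrej mB H0S; rewrite /FDR.
rewrite (expectation_finite_map P (Z := cell rej B) (g := fun z => FDP P z.1))//.
- by rewrite /FDP H0S.
- by move=> z; exact: measurable_cell.
- by move=> z; rewrite /FDP divr_ge0.
Qed.

Lemma coord_null {R : realType} {n : nat} (P : product_law R n) (i : 'I_n)
    (B : set R) (E : set (n.-tuple R)) :
  measurable B -> measurable E -> margin P i B = 0%E ->
  (forall y, E y -> B (tnth y i)) -> fine (P E) = 0.
Proof.
move=> mB mE B0 EB.
pose A j := if j == i then B else setT.
have mA j : measurable (A j) by rewrite /A; case: ifP.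
have PA : fine (P (box A)) = 0.
  by rewrite law_box// (bigD1 i)//= /A eqxx B0/= mul0r.
suff : (P E <= P (box A))%E.
  rewrite -probability_fineK// -[leRHS]probability_fineK ?PA//; last first.
    exact: measurable_box.
  rewrite lee_fin => P0; apply/eqP; rewrite eq_le P0/=.
  by have /andP[] := fine_prob01 P mE.
apply: le_measure; rewrite ?inE//; first exact: measurable_box.
by move=> y Ey j; rewrite /A; case: eqVneq => // ->; exact: EB.
Qed.

(** The same data may come from two models: in the first the alternatives avoid
    [B], in the second they lie in [B]. A rejection in [B] is thus false in the
    first model and a rejection outside [B] is false in the second, so that the
    two false discovery proportions sum to at least 1 whenever something is
    rejected. *)
Lemma testing_tradeoff {R : realType} {n : nat} (p1 p2 : R)
    (nu1 f1 nu2 f2 : probability R R) (B : set R)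
    (P1 P2 : {set 'I_n} -> product_law R n)
    (rej : n.-tuple R -> {set 'I_n}) :
  0 <= p1 <= 1 -> 0 <= p2 <= 1 ->
  (forall S i, margin (P1 S) i = if i \in S then f1 else nu1) ->
  (forall S i, margin (P2 S) i = if i \in S then f2 else nu2) ->
  (forall A, measurable A ->
     p1 * fine (f1 A) + (1 - p1) * fine (nu1 A) =
     p2 * fine (f2 A) + (1 - p2) * fine (nu2 A)) ->
  measurable B -> f1 B = 0%E -> f2 (~` B) = 0%E ->
  testing_procedure rej ->
  \sum_S bern (fun=> p1) S * fine (P1 S [set y | rej y != finset.set0]) <=
  \sum_S bern (fun=> p1) S * cell_fdr (P1 S) rej B S +
  \sum_S bern (fun=> p2) S * cell_fdr (P2 S) rej B S.
Proof.
move=> p101 p201 M1 M2 eqm mB f1B f2B mrej; rewrite /cell_fdr.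
have mcell z : measurable [set y | cell rej B y = z] by exact: measurable_cell.
pose q z := \sum_S bern (fun=> p1) S * fine (P1 S [set y | cell rej B y = z]).
have qE z : q z = \sum_S bern (fun=> p2) S * fine (P2 S [set y | cell rej B y = z]).
  exact: (mixture_law_eq p101 p201 M1 M2 eqm).
have q0 z : 0 <= q z.
  apply: sumr_ge0 => S _; rewrite mulr_ge0 ?bern_ge0//.
  by have /andP[] := fine_prob01 (P1 S) (mcell z).
have -> : \sum_S bern (fun=> p1) S * fine (P1 S [set y | rej y != finset.set0]) =
    \sum_(z | z.1 != finset.set0) q z.
  rewrite exchange_big/=; apply: eq_bigr => S _.
  rewrite (prob_finite_map (P1 S) (Z := cell rej B) (fun z => z.1 != finset.set0))//.
  by rewrite mulr_sumr.
(* shares of the rejections in [B], respectively outside [B] *)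
pose a (z : {set 'I_n} * {set 'I_n}) : R := #|z.1 :&: z.2|%:R / (maxn #|z.1| 1)%:R.
pose b (z : {set 'I_n} * {set 'I_n}) : R := #|z.1 :&: ~: z.2|%:R / (maxn #|z.1| 1)%:R.
have a0 z : 0 <= a z by rewrite divr_ge0.
have b0 z : 0 <= b z by rewrite divr_ge0.
apply: (@le_trans _ _ (\sum_z (a z * q z + b z * q z))).
  rewrite big_mkcond/=; apply: ler_sum => z _; case: ifPn => z0; last first.
    by rewrite addr_ge0// mulr_ge0.
  rewrite -mulrDl ler_peMl// /a /b -mulrDl -natrD -finset.setDE cardsID.
  have z1 : (0 < #|z.1|)%N by rewrite card_gt0.
  by rewrite (maxn_idPl z1) divff// pnatr_eq0 -lt0n.
rewrite big_split/=; apply: lerD.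
  under eq_bigr => z _ do rewrite mulr_sumr.
  rewrite exchange_big/=; apply: ler_sum => S _.
  rewrite mulr_sumr; apply: ler_sum => z _.
  rewrite mulrCA ler_wpM2l ?bern_ge0//.
  have /andP[c0 _] := fine_prob01 (P1 S) (mcell z).
  (* a cell where an alternative falls in [B] has probability 0 *)
  have [disj|/pred0Pn[i /andP[/= iz iS]]] := boolP [disjoint z.2 & S].
    rewrite ler_wpM2r// ler_wpM2r// ler_nat subset_leq_card//.
    by rewrite finset.setIS// -finset.disjoints_subset.
  rewrite (@coord_null _ _ _ i B)// ?mulr0//; first by rewrite M1 iS.
  by move=> y /= zE; move: iz; rewrite -zE inE => /asboolP.
under eq_bigr => z _ do rewrite qE mulr_sumr.
rewrite exchange_big/=; apply: ler_sum => S _.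
rewrite mulr_sumr; apply: ler_sum => z _.
rewrite mulrCA ler_wpM2l ?bern_ge0//.
have /andP[c0 _] := fine_prob01 (P2 S) (mcell z).
(* a cell where an alternative falls outside [B] has probability 0 *)
have [sub|/subsetPn[i iS iz]] := boolP (S \subset z.2).
  rewrite ler_wpM2r// ler_wpM2r// ler_nat subset_leq_card//.
  by rewrite finset.setIS// finset.setCS.
rewrite (@coord_null _ _ _ i (~` B))// ?mulr0//.
- exact: measurableC.
- by rewrite M2 iS.
- by move=> y /= zE By; move: iz; rewrite -zE inE => /asboolP.
Qed.

(** * Uniqueness of the null parameters *)

Lemma normal_pdf_gt0 {R : realType} (m s x : R) : s != 0 -> 0 < normal_pdf m s x.
Proof.
by move=> s0; rewrite normal_pdfE// mulr_gt0 ?normal_peak_gt0// expR_gt0.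
Qed.

(** Equal laws have almost everywhere equal densities, while continuous functions
    that differ at a point differ on a ball, which has positive length. *)
Lemma normal_pdf_inj {R : realType} (m m' s s' : R) : 0 < s -> 0 < s' ->
  (forall A, measurable A -> normal_prob m s A = normal_prob m' s' A) ->
  forall x, normal_pdf m s x = normal_pdf m' s' x.
Proof.
move=> s0 s'0 eqA x; apply/eqP/negPn/negP => neq.
have ms : measurable_fun [set: R] (EFin \o normal_pdf m s).
  by apply/measurable_EFinP; exact: measurable_normal_pdf.
have ms' : measurable_fun [set: R] (EFin \o normal_pdf m' s').
  by apply/measurable_EFinP; exact: measurable_normal_pdf.
have [N [mN N0 subN]] := integral_ae_eq measurableT (integrable_normal_pdf m s) ms'
  (fun E _ mE => eqA E mE).
pose h y := normal_pdf m s y - normal_pdf m' s' y.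
have hc : {for x, continuous h}.
  by apply: continuousB; apply: continuous_normal_pdf; rewrite gt_eqF.
have hx : 0 < `|h x| by rewrite normr_gt0 subr_eq0.
have /nbhs_ballP[e /= e0 be] : \forall y \near x, 0 < `|h y|.
  have : {for x, continuous (fun y => `|h y|)} by apply: cvg_norm.
  by move=> /(_ _ (lt_nbhsr hx)).
suff : (lebesgue_measure (ball x e) <= lebesgue_measure N)%E.
  rewrite N0 lebesgue_measure_ball ?(ltW e0)// lee_fin.
  by rewrite leNgt mulr2n addr_gt0.
apply: le_measure; rewrite ?inE//; first exact: measurable_ball.
move=> y /be; rewrite normr_gt0 => hy; apply: subN => /= /(_ Logic.I) [E].
by move: hy; rewrite /h E subrr eqxx.
Qed.

(** The height of the peak determines the standard deviation, and its location
    the mean. *)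
Lemma normal_prob_inj {R : realType} (m m' s s' : R) : 0 < s -> 0 < s' ->
  (forall A, measurable A -> normal_prob m s A = normal_prob m' s' A) ->
  m = m' /\ s = s'.
Proof.
move=> s0 s'0 eqA; have pdfE := normal_pdf_inj s0 s'0 eqA.
have sn : s != 0 by rewrite gt_eqF.
have s'n : s' != 0 by rewrite gt_eqF.
have peakE (u v : R) : v != 0 -> normal_pdf u v u = normal_peak v.
  move=> v0; rewrite normal_pdfE// /normal_fun subrr expr0n/= oppr0 mul0r expR0.
  by rewrite mulr1.
have pk : normal_peak s = normal_peak s'.
  apply/eqP; rewrite eq_le; apply/andP; split.
    by rewrite -(peakE m)// pdfE normal_pdf_ub.
  by rewrite -(peakE m')// -pdfE normal_pdf_ub.
have ss : s = s'.
  move: pk; rewrite /normal_peak => /invr_inj /eqP.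
  have pos (v : R) : 0 <= v ^+ 2 * pi *+ 2.
    by rewrite mulrn_wge0// mulr_ge0 ?sqr_ge0 ?pi_ge0.
  rewrite eqr_sqrt// -[_ *+ 2]mulr_natr -[X in _ == X]mulr_natr => /eqP.
  move=> /(mulIf (lt0r_neq0 (ltr0Sn R 1))) /(mulIf (lt0r_neq0 (pi_gt0 R))) /eqP.
  by rewrite eqrXn2 ?ltW// => /eqP.
split=> //; have := pdfE m; rewrite peakE// -ss normal_pdfE//.
rewrite -[X in X = _]mulr1 => /(mulfI (lt0r_neq0 (normal_peak_gt0 sn))).
rewrite -expR0 /normal_fun => /expR_inj /esym /eqP.
rewrite mulf_eq0 oppr_eq0 invr_eq0 mulrn_eq0 /= !sqrf_eq0 (negbTE sn) orbF.
by rewrite subr_eq0 => /eqP.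
Qed.

Lemma majorities_meet {R : realType} {n : nat} (A B : {set 'I_n}) :
  n%:R / 2 < #|A|%:R :> R -> n%:R / 2 < #|B|%:R :> R ->
  exists2 i, i \in A & i \in B.
Proof.
move=> cA cB; suff /set0Pn[i] : A :&: B != finset.set0.
  by rewrite finset.in_setI => /andP[]; exists i.
rewrite -card_gt0 -(ltr_nat R).
have UI : #|A :|: B|%:R + #|A :&: B|%:R = #|A|%:R + #|B|%:R :> R.
  by rewrite -!natrD cardsUI.
have Un : #|A :|: B|%:R <= n%:R :> R.
  by rewrite ler_nat -[leqRHS]card_ord max_card.
by lra.
Qed.

Lemma gaussian_coordsP {R : realType} {n : nat} (P : product_law R n) m s i :
  i \in gaussian_coords P m s <->
  (forall A : set R, measurable A -> margin P i A = normal_prob m s A).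
Proof. by rewrite finset.in_set; split => [/asboolP|?]; last exact/asboolP. Qed.

(** Two majorities of coordinates share an element, and the law of that
    coordinate determines the null parameters. The set [B] tells [f] from the
    null law, so that no element of [S] passes for a null. *)
Lemma null_model {R : realType} {n : nat} (P : product_law R n) (S : {set 'I_n})
    (s : R) (nu f : probability R R) (B : set R) :
  0 < s -> (forall A, nu A = normal_prob 0 s A) ->
  measurable B -> f B <> nu B ->
  (forall i, margin P i = if i \in S then f else nu) ->
  #|S|%:R < n%:R / 2 :> R ->
  [/\ has_null P, null_param P = (0, s), H1 P = S & H0 P = ~: S].
Proof.
move=> s0 nuE mB fB M cS.
have gc : gaussian_coords P 0 s = ~: S.
  apply/setP => i; rewrite !inE M; case: ifP => iS; last exact/asboolP.
  by apply/asboolP => /(_ _ mB); rewrite -nuE.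
have nul : is_null P (0, s).
  split => //=; rewrite gc cardsCs finset.setCK card_ord natrB; last first.
    by rewrite -[leqRHS]card_ord max_card.
  by lra.
have uniq : is_subset1 [set ts | is_null P ts].
  move=> [m1 s1] [m2 s2] /= [/= s10 c1] [/= s20 c2].
  have [i /gaussian_coordsP e1 /gaussian_coordsP e2] := majorities_meet c1 c2.
  have [] := @normal_prob_inj _ m1 m2 s1 s2 s10 s20; last by move=> -> ->.
  by move=> A mA; rewrite -e1// e2.
have np : null_param P = (0, s) by rewrite /null_param; exact: xget_subset1.
have h0 : H0 P = ~: S by rewrite /H0 /theta /sigma np.
split=> //; first by exists (0, s).
by rewrite /H1 h0 finset.setCK.
Qed.

(** * Masses of densities *)

Section density_probability.
Context {R : realType} (g : R -> R).
Hypotheses (mg : measurable_fun [set: R] g) (g0 : forall x, 0 <= g x)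
  (g1 : (\int[lebesgue_measure]_x (g x)%:E = 1)%E).

(** The properties of [g] are arguments so that unification recovers them when
    the probability structure is inferred. *)
Definition density_prob (_ : measurable_fun [set: R] g) (_ : forall x, 0 <= g x)
    (_ : (\int[lebesgue_measure]_x (g x)%:E = 1)%E) (A : set R) : \bar R :=
  (\int[lebesgue_measure]_(x in A) (g x)%:E)%E.

Let dens0 : density_prob mg g0 g1 set0 = 0%E.
Proof. by rewrite /density_prob integral_set0. Qed.

Let dens_ge0 A : (0 <= density_prob mg g0 g1 A)%E.
Proof. by apply: integral_ge0 => x _; rewrite lee_fin. Qed.

Let dens_sigma_additive : semi_sigma_additive (density_prob mg g0 g1).
Proof.
move=> /= A mA tA mUA.
rewrite /density_prob/= ge0_integral_bigcup//=.
- apply: is_cvg_ereal_nneg_natsum_cond => n _ _.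
  by apply: integral_ge0 => /= x ?; rewrite lee_fin.
- by apply: measurable_funTS; apply/measurable_EFinP.
- by move=> x _; rewrite lee_fin.
Qed.

HB.instance Definition _ := isMeasure.Build _ _ _
  (density_prob mg g0 g1) dens0 dens_ge0 dens_sigma_additive.

Let dens_setT : density_prob mg g0 g1 [set: _] = 1%E.
Proof. exact: g1. Qed.

HB.instance Definition _ :=
  Measure_isProbability.Build _ _ R (density_prob mg g0 g1) dens_setT.

End density_probability.

Lemma density_probability_ex {R : realType} (g : R -> R) :
  measurable_fun [set: R] g -> (forall x, 0 <= g x) ->
  (\int[lebesgue_measure]_x (g x)%:E = 1)%E ->
  exists P : probability R R,
    forall A, P A = (\int[lebesgue_measure]_(x in A) (g x)%:E)%E.
Proof. by move=> mg g0 g1; exists (density_prob mg g0 g1 : probability R R). Qed.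

Local Notation mu := lebesgue_measure.

Definition mass {R : realType} (h : R -> R) (A : set R) : R :=
  fine (\int[mu]_(x in A) (h x)%:E)%E.

Definition subdensity {R : realType} (h : R -> R) : Prop :=
  [/\ measurable_fun [set: R] h, (forall x, 0 <= h x) &
      (\int[mu]_x (h x)%:E < +oo)%E].

Lemma massE {R : realType} (h : R -> R) (A : set R) :
  subdensity h -> measurable A ->
  (\int[mu]_(x in A) (h x)%:E)%E = (mass h A)%:E.
Proof.
move=> [mh h0 hoo] mA; rewrite /mass fineK// ge0_fin_numE.
  apply: le_lt_trans hoo; apply: ge0_subset_integral => //.
  - exact/measurable_EFinP.
  - by move=> x _; rewrite lee_fin.
by apply: integral_ge0 => x _; rewrite lee_fin.
Qed.

Lemma mass_ge0 {R : realType} (h : R -> R) (A : set R) :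
  (forall x, 0 <= h x) -> 0 <= mass h A.
Proof.
by move=> h0; apply/fine_ge0/integral_ge0 => x _; rewrite lee_fin.
Qed.

Lemma le_mass {R : realType} (h k : R -> R) (c : R) (A B : set R) :
  subdensity h -> subdensity k -> measurable A -> measurable B -> A `<=` B ->
  0 <= c -> (forall x, A x -> c * h x <= k x) -> c * mass h A <= mass k B.
Proof.
move=> sh sk mA mB AB c0 hk; have [mh h0 _] := sh; have [mk k0 _] := sk.
rewrite -lee_fin EFinM -!massE//.
have mAh (g : R -> R) (C : set R) : measurable_fun setT g -> measurable_fun C (EFin \o g).
  by move=> mg; apply: measurable_funTS; apply/measurable_EFinP.
rewrite -ge0_integralZl//; last 2 first.
- exact: mAh.
- by move=> x _; rewrite lee_fin.
apply: (@le_trans _ _ (\int[mu]_(x in A) (k x)%:E)%E).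
  apply: ge0_le_integral => //.
  - by move=> x _; rewrite -EFinM lee_fin mulr_ge0.
  - by apply: measurable_funeM; exact: mAh.
  - exact: mAh.
apply: ge0_subset_integral => //; first exact: mAh.
by move=> x _; rewrite lee_fin.
Qed.

Lemma massD {R : realType} (h k : R -> R) (A : set R) :
  subdensity h -> subdensity k -> measurable A ->
  mass (h \+ k) A = mass h A + mass k A.
Proof.
move=> sh sk mA; have [mh h0 _] := sh; have [mk k0 _] := sk.
apply: EFin_inj; rewrite EFinD -!massE//.
  rewrite -ge0_integralD//.
  - by move=> x _; rewrite lee_fin.
  - by apply: measurable_funTS; apply/measurable_EFinP.
  - by move=> x _; rewrite lee_fin.
  - by apply: measurable_funTS; apply/measurable_EFinP.
split; first exact: measurable_funD.
  by move=> x; rewrite addr_ge0.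
under eq_integral do rewrite EFinD.
rewrite ge0_integralD//.
- by rewrite !massE// -EFinD ltry.
- by move=> x _; rewrite lee_fin.
- exact/measurable_EFinP.
- by move=> x _; rewrite lee_fin.
- exact/measurable_EFinP.
Qed.

Lemma subdensity_le {R : realType} (h k : R -> R) (c : R) :
  measurable_fun [set: R] h -> subdensity k -> 0 <= c ->
  (forall x, 0 <= h x <= c * k x) -> subdensity h.
Proof.
move=> mh [mk k0 koo] c0 hk.
have h0 x : 0 <= h x by case/andP: (hk x).
split=> //; apply: (@le_lt_trans _ _ (\int[mu]_x (c%:E * (k x)%:E))%E).
  apply: ge0_le_integral => //.
  - by move=> x _; rewrite lee_fin.
  - exact/measurable_EFinP.
  - by apply: measurable_funeM; apply/measurable_EFinP.
  - by move=> x _; rewrite -EFinM lee_fin; case/andP: (hk x).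
rewrite ge0_integralZl//.
- by rewrite lte_mul_pinfty// lee_fin.
- exact/measurable_EFinP.
- by move=> x _; rewrite lee_fin.
Qed.

Lemma subdensity_normal {R : realType} (s : R) : subdensity (normal_pdf 0 s).
Proof.
split; first exact: measurable_normal_pdf.
  by move=> x; exact: normal_pdf_ge0.
by rewrite integral_normal_pdf ltry.
Qed.

Lemma mass_normal {R : realType} (s : R) (A : set R) :
  mass (normal_pdf 0 s) A = fine (normal_prob 0 s A).
Proof. by []. Qed.

Lemma mass_normalT {R : realType} (s : R) : mass (normal_pdf 0 s) setT = 1.
Proof. by rewrite /mass integral_normal_pdf. Qed.

Lemma normalized_ex {R : realType} (h : R -> R) :
  subdensity h -> 0 < mass h setT ->
  exists P : probability R R, forall A, measurable A ->
    fine (P A) = mass h A / mass h setT.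
Proof.
move=> sh a0; have [mh h0 _] := sh; set a := mass h setT in a0 *.
have int A : measurable A ->
    (\int[mu]_(x in A) (a^-1 * h x)%:E = (a^-1 * mass h A)%:E)%E.
  move=> mA; under eq_integral do rewrite EFinM.
  rewrite ge0_integralZl//.
  - by rewrite massE// -EFinM.
  - by apply: measurable_funTS; apply/measurable_EFinP.
  - by move=> x _; rewrite lee_fin.
  - by rewrite lee_fin invr_ge0 ltW.
have [|||P PE] := @density_probability_ex R (fun x => a^-1 * h x).
- exact: measurable_funM.
- by move=> x; rewrite mulr_ge0// invr_ge0 ltW.
- by rewrite int// mulVf// gt_eqF.
by exists P => A mA; rewrite PE int//= mulrC.
Qed.

Lemma le_mass_cst {R : realType} (h : R -> R) (c x y : R) (A : set R) :
  subdensity h -> measurable A -> 0 <= c -> x <= y -> `]x, y[%classic `<=` A ->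
  (forall z, x < z < y -> c <= h z) -> c * (y - x) <= mass h A.
Proof.
move=> sh mA c0 xy subA ch; have [mh h0 _] := sh.
rewrite -lee_fin -massE//.
apply: (@le_trans _ _ (\int[mu]_(x in `]x, y[) (h x)%:E)%E); last first.
  apply: ge0_subset_integral => //.
  - by apply: measurable_funTS; apply/measurable_EFinP.
  - by move=> z _; rewrite lee_fin.
apply: (@le_trans _ _ (\int[mu]_(z in `]x, y[) c%:E)%E).
  rewrite integral_cst//= lebesgue_measure_itv/= lte_fin.
  case: ltP => [_|yx]; first by rewrite -EFinB -EFinM.
  have -> : y = x by apply: le_anti; rewrite xy yx.
  by rewrite subrr mulr0 mule0.
apply: ge0_le_integral => //.
by apply: measurable_funTS; apply/measurable_EFinP.
Qed.

(** * The pair of mixtures *)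

(** The density of a centred normal law of variance 1 / (1 - d), multiplied by the
    constant that makes it cross the standard normal density at |x| = t
    ([tiltE]). *)
Definition tilt {R : realType} (d t x : R) : R :=
  normal_pdf 0 1 x * expR (d * (x ^+ 2 - t ^+ 2) / 2).

Lemma normal_peakE {R : realType} (s : R) : 0 < s ->
  normal_peak s = normal_peak 1 / s.
Proof.
move=> s0; rewrite /normal_peak expr1n mul1r -mulrnAr sqrtrM ?sqr_ge0//.
by rewrite sqrtr_sqr gtr0_norm// invfM mulrC.
Qed.

Lemma normal_pdf0E {R : realType} (s x : R) : 0 < s ->
  normal_pdf 0 s x = normal_peak 1 / s * expR (- (x ^+ 2 / s ^+ 2 / 2)).
Proof.
move=> s0; rewrite normal_pdfE ?gt_eqF// normal_peakE// /normal_fun subr0.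
congr (_ * expR _); rewrite mulNr; congr (- _).
by rewrite -mulr_natr invfM mulrA mulrAC.
Qed.

Lemma normal_pdf01E {R : realType} (x : R) :
  normal_pdf 0 1 x = normal_peak 1 * expR (- (x ^+ 2 / 2)).
Proof. by rewrite normal_pdf0E// expr1n !divr1. Qed.

Lemma tiltE {R : realType} (d t x : R) : 0 < d < 1 ->
  tilt d t x = (Num.sqrt (1 - d))^-1 * expR (- (d * t ^+ 2 / 2)) *
               normal_pdf 0 (Num.sqrt (1 - d))^-1 x.
Proof.
move=> /andP[d0 d1]; set s := (Num.sqrt (1 - d))^-1.
have s0 : 0 < s by rewrite invr_gt0 sqrtr_gt0 subr_gt0.
have s2 : (s ^+ 2)^-1 = 1 - d.
  by rewrite /s exprVn invrK sqr_sqrtr// subr_ge0 ltW.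
rewrite /tilt normal_pdf01E normal_pdf0E//.
have -> : s * expR (- (d * t ^+ 2 / 2)) *
    (normal_peak 1 / s * expR (- (x ^+ 2 / s ^+ 2 / 2))) =
    normal_peak 1 * (expR (- (d * t ^+ 2 / 2)) * expR (- (x ^+ 2 / s ^+ 2 / 2))).
  by field; rewrite gt_eqF.
rewrite -[LHS]mulrA -!expRD s2; congr (_ * expR _); by field.
Qed.

(** With u = d (x^2 - t^2) / 2, the inequality exp u - 1 <= u exp u provides the
    factor d, which a bound by [tilt] alone would lose. What remains of the
    Gaussian exponent after absorbing x^2 and exp u pays for both
    exp(-t^2/16) and an integrable N(0, 2) density. *)
Lemma tilt_sub_le {R : realType} (d t x : R) :
  0 < d <= 4^-1 -> t ^+ 2 <= x ^+ 2 ->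
  tilt d t x - normal_pdf 0 1 x <=
  12 * d * expR (- (t ^+ 2 / 16)) * normal_pdf 0 (Num.sqrt 2) x.
Proof.
move=> /andP[d0 d4] tx.
set y := x ^+ 2 in tx *.
have y0 : 0 <= y by rewrite sqr_ge0.
have s2 : 0 < Num.sqrt 2 :> R by rewrite sqrtr_gt0.
rewrite /tilt normal_pdf01E (normal_pdf0E _ s2) -/y sqr_sqrtr//.
set u := d * (y - t ^+ 2) / 2.
have u0 : 0 <= u by rewrite /u divr_ge0// mulr_ge0 ?subr_ge0// ltW.
have uy : u <= d * y / 2.
  by rewrite /u ler_pM2r ?invr_gt0// ler_wpM2l ?(ltW d0)// gerBl sqr_ge0.
have uy8 : u <= y / 8.
  apply: (le_trans uy); have : d * y <= 4^-1 * y by rewrite ler_wpM2r.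
  by lra.
have e1 : expR u - 1 <= u * expR u.
  have := expR_ge1Dx (- u); rewrite expRN => h.
  have eu := expR_gt0 u.
  have : (1 - u) * expR u <= 1 by rewrite -ler_pdivlMr// div1r.
  by lra.
have e2 : y / 16 <= expR (y / 16).
  by apply: le_trans (expR_ge1Dx _); rewrite lerDr.
have e3 : expR u - 1 <= 8 * d * expR (3 * y / 16).
  apply: (le_trans e1).
  have -> : 3 * y / 16 = y / 16 + y / 8 by field.
  rewrite expRD mulrA ler_pM ?expR_ge0 ?ler_expR//.
  apply: (le_trans uy).
  have -> : d * y / 2 = 8 * d * (y / 16) by field.
  by rewrite ler_wpM2l// mulr_ge0// ltW.
have p0 := normal_peak_gt0 (oner_neq0 R).
have e4 : expR (3 * y / 16) * expR (- (y / 2)) <=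
          expR (- (t ^+ 2 / 16)) * expR (- (y / 2 / 2)).
  by rewrite -!expRD ler_expR; lra.
have s212 : 8 * Num.sqrt 2 <= 12 :> R.
  rewrite -(@ler_pXn2r _ 2)// ?nnegrE ?mulr_ge0 ?sqrtr_ge0//.
  by rewrite exprMn sqr_sqrtr//; lra.
have -> : normal_peak 1 * expR (- (y / 2)) * expR u - normal_peak 1 * expR (- (y / 2)) =
   normal_peak 1 * ((expR u - 1) * expR (- (y / 2))) by ring.
have -> : 12 * d * expR (- (t ^+ 2 / 16)) *
    (normal_peak 1 / Num.sqrt 2 * expR (- (y / 2 / 2))) =
   normal_peak 1 * (12 / Num.sqrt 2 * d *
     (expR (- (t ^+ 2 / 16)) * expR (- (y / 2 / 2)))).
  by ring.
rewrite ler_wpM2l ?(ltW p0)//.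
apply: (@le_trans _ _ (8 * d * (expR (3 * y / 16) * expR (- (y / 2))))).
  by rewrite mulrA ler_wpM2r ?expR_ge0.
apply: ler_pM => //; first by rewrite mulr_ge0// ltW.
by rewrite ler_wpM2r ?(ltW d0)// ler_pdivlMr.
Qed.

Definition far {R : realType} (t : R) : set R := [set x | t < `|x|].

Lemma measurable_far {R : realType} (t : R) : measurable (far t).
Proof.
have -> : far t = setT `&` (fun x : R => `|x|) @^-1` `]t, +oo[.
  by apply/seteqP; split=> x; rewrite /far setTI/= in_itv/= andbT.
exact: (normr_measurable measurableT).
Qed.

Lemma farP {R : realType} (t x : R) : 0 <= t -> far t x <-> t ^+ 2 < x ^+ 2.
Proof.
move=> t0; rewrite /far/= -(@real_normK _ x) ?num_real//.
by rewrite ltr_pXn2r// nnegrE.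
Qed.

Lemma tilt_far {R : realType} (d t X x : R) : 0 < d -> 0 <= X -> far X x ->
  (expR (d * (X ^+ 2 - t ^+ 2) / 2) - 1) * normal_pdf 0 1 x <=
  tilt d t x - normal_pdf 0 1 x.
Proof.
move=> d0 X0 /farP-/(_ X0) Xx; rewrite /tilt [leLHS]mulrBl mul1r lerBlDr subrK mulrC.
rewrite ler_wpM2l ?normal_pdf_ge0// ler_expR ler_pM2r// ler_wpM2l ?(ltW d0)//.
by rewrite lerD2r ltW.
Qed.

Lemma normal_pdf_anti {R : realType} (x y : R) : x ^+ 2 <= y ^+ 2 ->
  normal_pdf 0 1 y <= normal_pdf 0 1 x.
Proof.
move=> xy; rewrite !normal_pdf01E ler_wpM2l ?normal_peak_ge0// ler_expR lerN2.
by rewrite ler_pM2r.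
Qed.

Lemma expR_ge1 {R : realType} (u : R) : (1 <= expR u) = (0 <= u).
Proof. by rewrite -[X in X <= _]expR0 ler_expR. Qed.

(** Two ways to write one distribution as a mixture of a centred normal law and
    of alternatives. The alternatives lie in |x| > t for the first and in
    |x| <= t for the second; the last two fields say that the null laws charge
    the other side, hence differ from the alternatives. *)
Record mixture_pair {R : realType} (t : R) := MixturePair {
  null1 : probability R R ; alt1 : probability R R ; freq1 : R ;
  null2 : probability R R ; alt2 : probability R R ; freq2 : R ;
  sd2 : R ;
  sd2_gt0 : 0 < sd2 ;
  null1E : forall A, null1 A = normal_prob 0 1 A ;
  null2E : forall A, null2 A = normal_prob 0 sd2 A ;
  freq1_01 : 0 <= freq1 <= 1 ;
  freq2_01 : 0 <= freq2 <= 1 ;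
  mixtureE : forall A, measurable A ->
     freq1 * fine (alt1 A) + (1 - freq1) * fine (null1 A) =
     freq2 * fine (alt2 A) + (1 - freq2) * fine (null2 A) ;
  alt1_near : alt1 (~` far t) = 0%E ;
  alt2_far : alt2 (far t) = 0%E ;
  null1_near : null1 (~` far t) != 0%E ;
  null2_far : null2 (far t) != 0%E }.

Lemma normal_law_ex {R : realType} (s : R) :
  exists nu : probability R R, forall A, nu A = normal_prob 0 s A.
Proof.
have [|||nu nuE] := @density_probability_ex R (normal_pdf 0 s).
- exact: measurable_normal_pdf.
- by move=> x; exact: normal_pdf_ge0.
- exact: integral_normal_pdf.
by exists nu.
Qed.

Lemma mass_eq0 {R : realType} (h : R -> R) (A : set R) :
  (forall x, A x -> h x = 0) -> mass h A = 0.
Proof.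
move=> h0; rewrite /mass (eq_integral (cst 0%E)) ?integral0//.
by move=> x /set_mem Ax; rewrite h0.
Qed.

(** Write phi for the standard normal density, g for [tilt d t], r for the total
    mass of g, a for that of (g - phi)^+ and b for that of (phi - g)^+. The
    identity phi + (g - phi)^+ = g + (phi - g)^+, divided by its total mass
    1 + a = r + b, is the required pair of mixtures, with proportions
    a / (1 + a) and b / (1 + a). Since r >= 1 - d t^2 / 2, the second one is at
    most d t^2 / 2 + a. *)
Lemma mixture_pair_ex {R : realType} (d t : R) :
  0 < d <= 12^-1 -> 2 <= t ->
  exists M : mixture_pair t,
    [/\ freq1 M <= 12 * d * expR (- (t ^+ 2 / 16)),
        freq2 M <= d * t ^+ 2 / 2 + 12 * d * expR (- (t ^+ 2 / 16)) &
        forall X, t <= X ->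
          (expR (d * (X ^+ 2 - t ^+ 2) / 2) - 1) * normal_tail X <=
          2 * (freq1 M * fine (alt1 M (far X)))].
Proof.
move=> /andP[d0 d12] t2; have t0 : 0 < t by rewrite (lt_le_trans _ t2).
have d1 : 0 < d < 1.
  by rewrite d0/=; apply: le_lt_trans d12 _; rewrite invf_lt1// ltr1n.
have d4 : 0 < d <= 4^-1.
  by rewrite d0/=; apply: le_trans d12 _; rewrite lef_pV2 ?posrE// ler_nat.
set s := (Num.sqrt (1 - d))^-1; set r := s * expR (- (d * t ^+ 2 / 2)).
have s0 : 0 < s by rewrite invr_gt0 sqrtr_gt0 subr_gt0; case/andP: d1.
have r0 : 0 < r by rewrite mulr_gt0 ?expR_gt0.
have s1 : 1 <= s.
  rewrite /s invf_ge1 ?sqrtr_gt0 ?subr_gt0; last by case/andP: d1.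
  by rewrite -[leRHS]sqrtr1 ler_sqrt// gerBl ltW.
have r_ge : 1 - d * t ^+ 2 / 2 <= r.
  apply: le_trans (expR_ge1Dx _) _.
  by rewrite /r ler_peMl ?expR_ge0.
pose phi : R -> R := normal_pdf 0 1; pose g := tilt d t.
have gE x : g x = r * normal_pdf 0 s x by exact: tiltE.
have sphi : subdensity phi by exact: subdensity_normal.
have sns := subdensity_normal s; have sn2 := @subdensity_normal R (Num.sqrt 2).
have mg : measurable_fun setT g.
  rewrite (_ : g = fun x => r * normal_pdf 0 s x); last exact/funext.
  by apply: measurable_funM => //; exact: measurable_normal_pdf.
have g0 x : 0 <= g x by rewrite /g /tilt mulr_ge0 ?normal_pdf_ge0 ?expR_ge0.
have phi0 x : 0 <= phi x by exact: normal_pdf_ge0.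
have sg : subdensity g.
  apply: (subdensity_le (c := r) mg (subdensity_normal s)); first exact: ltW.
  by move=> x; rewrite g0 gE/=.
pose up x := Num.max (g x - phi x) 0; pose dn x := Num.max (phi x - g x) 0.
have up0 x : 0 <= up x by rewrite le_max lexx orbT.
have dn0 x : 0 <= dn x by rewrite le_max lexx orbT.
have mphi : measurable_fun setT phi by exact: measurable_normal_pdf.
have sup : subdensity up.
  apply: (subdensity_le (c := 1) _ sg) => //.
    by apply: measurable_maxr => //; exact: measurable_funB.
  by move=> x; rewrite up0 mul1r ge_max g0 gerBl phi0.
have sdn : subdensity dn.
  apply: (subdensity_le (c := 1) _ sphi) => //.
    by apply: measurable_maxr => //; exact: measurable_funB.
  by move=> x; rewrite dn0 mul1r ge_max phi0 gerBl g0.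
have updn : phi \+ up = g \+ dn.
  apply/funext => x; rewrite /up /dn/=.
  by case: (leP (g x - phi x) 0); case: (leP (phi x - g x) 0); lra.
have massg A : measurable A -> mass g A = r * mass (normal_pdf 0 s) A.
  move=> mA; apply: EFin_inj; rewrite -(massE sg mA) EFinM -(massE sns mA).
  rewrite -ge0_integralZl ?lee_fin ?(ltW r0)//.
  - by apply: eq_integral => x _; rewrite gE.
  - by apply: measurable_funTS; apply/measurable_EFinP; exact: measurable_normal_pdf.
  - by move=> x _; rewrite lee_fin normal_pdf_ge0.
have key A : measurable A ->
    mass phi A + mass up A = r * mass (normal_pdf 0 s) A + mass dn A.
  by move=> mA; rewrite -massg// -!massD// updn.
set a := mass up setT; set b := mass dn setT.
have keyT : 1 + a = r + b.
  by have := key _ measurableT; rewrite !mass_normalT mulr1.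
have far_up x : ~ far t x -> up x = 0.
  move=> nf; apply/max_idPr; rewrite subr_le0.
  have {}nf : x ^+ 2 <= t ^+ 2.
    by rewrite leNgt; apply/negP => tx; apply: nf; apply/farP => //; exact: ltW.
  rewrite /g /tilt ler_piMr ?normal_pdf_ge0// expR_le1.
  by rewrite pmulr_lle0// pmulr_rle0// subr_le0.
have far_dn x : far t x -> dn x = 0.
  move=> /farP-/(_ (ltW t0)) tx; apply/max_idPr; rewrite subr_le0.
  rewrite /g /tilt ler_peMr ?normal_pdf_ge0// expR_ge1.
  by rewrite divr_ge0// mulr_ge0 ?(ltW d0)// subr_ge0 ltW.
have a_le : a <= 12 * d * expR (- (t ^+ 2 / 16)).
  set c := 12 * d * _; have c0 : 0 < c by rewrite !mulr_gt0 ?expR_gt0.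
  have : c^-1 * a <= mass (normal_pdf 0 (Num.sqrt 2)) setT.
    apply: (le_mass sup sn2) => //; first by rewrite invr_ge0 ltW.
    move=> x _; rewrite mulrC ler_pdivrMr// mulrC.
    have [tx|tx] := ltP t `|x|; last first.
      rewrite far_up; first by rewrite mulr_ge0 ?normal_pdf_ge0 ?(ltW c0).
      by move=> xt; have := le_lt_trans tx xt; rewrite ltxx.
    rewrite ge_max tilt_sub_le//=; last first.
      by apply/ltW/farP => //; exact: ltW.
    by rewrite mulr_ge0 ?normal_pdf_ge0 ?(ltW c0).
  by rewrite mass_normalT mulrC ler_pdivrMr// mul1r.
have up_far X x : t <= X -> far X x ->
    (expR (d * (X ^+ 2 - t ^+ 2) / 2) - 1) * phi x <= up x.
  move=> tX Xx; rewrite /up le_max; apply/orP; left.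
  by apply: tilt_far => //; rewrite (le_trans _ tX)// ltW.
(* the alternatives of the first model charge the interval from t + 1 to t + 2 *)
have a_gt0 : 0 < a.
  pose c := (expR (d * ((t + 1) ^+ 2 - t ^+ 2) / 2) - 1) * phi (t + 2).
  have c0 : 0 < c.
    rewrite mulr_gt0 ?normal_pdf_gt0// subr_gt0 expR_gt1.
    rewrite divr_gt0// mulr_gt0// subr_gt0.
    by rewrite ltr_pXn2r// ?nnegrE ?addr_ge0 ?(ltW t0)// ltrDl.
  apply: (@lt_le_trans _ _ (c * (t + 2 - (t + 1)))).
    by rewrite mulr_gt0//; lra.
  apply: le_mass_cst => //; first exact: ltW.
    by lra.
  move=> z /andP[z1 z2].
  apply: le_trans (up_far (t + 1) z _ _); last 2 first.
  - by rewrite lerDl.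
  - by rewrite /far/= ltr_normr z1.
  rewrite ler_wpM2l//.
    rewrite subr_ge0 expR_ge1.
    rewrite divr_ge0// mulr_ge0 ?(ltW d0)// subr_ge0.
    by rewrite ler_pXn2r// ?nnegrE ?addr_ge0 ?(ltW t0)// lerDl.
  apply: normal_pdf_anti; rewrite ler_pXn2r ?nnegrE ?ltW//; lra.
(* the alternatives of the second model charge the interval from -1 to 1 *)
have b_gt0 : 0 < b.
  pose c := (1 - expR (d * (1 - t ^+ 2) / 2)) * phi 1.
  have t21 : 1 < t ^+ 2.
    by rewrite expr_gt1 ?(ltW t0)//; apply: lt_le_trans t2; rewrite ltr1n.
  have c0 : 0 < c.
    rewrite mulr_gt0 ?normal_pdf_gt0// subr_gt0 expR_lt1.
    by rewrite pmulr_llt0// pmulr_rlt0// subr_lt0.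
  apply: (@lt_le_trans _ _ (c * (1 - (-1)))); first by rewrite mulr_gt0//; lra.
  apply: le_mass_cst => //; first exact: ltW.
  move=> z /andP[z1 z2].
  have zz : z ^+ 2 <= 1.
    by rewrite -real_normK ?num_real// expr_le1// ler_norml (ltW z1) (ltW z2).
  rewrite /dn le_max; apply/orP; left.
  have -> : phi z - g z = (1 - expR (d * (z ^+ 2 - t ^+ 2) / 2)) * phi z.
    by rewrite /g /tilt /phi; ring.
  apply: ler_pM.
  - by rewrite subr_ge0 expR_le1 pmulr_lle0// pmulr_rle0// subr_le0 ltW.
  - exact: phi0.
  - by rewrite lerD2l lerN2 ler_expR ler_pM2r// ler_pM2l// lerD2r.
  - by apply: normal_pdf_anti; rewrite expr1n.
have a1 : a <= 1.
  apply: (le_trans a_le); have dd : 12 * d <= 1 by rewrite mulrC -ler_pdivlMr// div1r.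
  apply: (le_trans _ dd); rewrite ler_piMr ?mulr_ge0 ?(ltW d0)//.
  by rewrite expR_le1 oppr_le0 divr_ge0// sqr_ge0.
have [n1 n1E] := normal_law_ex (1 : R); have [n2 n2E] := normal_law_ex s.
have [F1 F1E] := normalized_ex sup a_gt0.
have [F2 F2E] := normalized_ex sdn b_gt0.
have c1 : 0 < 1 + a by rewrite addr_gt0.
have nfar : measurable (~` far t) by apply: measurableC; exact: measurable_far.
have mfar X : measurable (far X : set R) by exact: measurable_far.
have zeroP (P : probability R R) A : measurable A -> fine (P A) = 0 -> P A = 0%E.
  by move=> mA PA; rewrite -probability_fineK// PA.
have M : [/\ 0 <= a / (1 + a) <= 1, 0 <= b / (1 + a) <= 1,
   (forall A, measurable A ->
     a / (1 + a) * fine (F1 A) + (1 - a / (1 + a)) * fine (n1 A) =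
     b / (1 + a) * fine (F2 A) + (1 - b / (1 + a)) * fine (n2 A)),
   F1 (~` far t) = 0%E & F2 (far t) = 0%E].
  split.
  - by rewrite divr_ge0 ?(ltW a_gt0) ?(ltW c1)//= ler_pdivrMr// mul1r lerDr.
  - rewrite divr_ge0 ?(ltW b_gt0) ?(ltW c1)//= ler_pdivrMr// mul1r keyT.
    by rewrite lerDr ltW.
  - move=> A mA; rewrite F1E// F2E// n1E n2E -!mass_normal -/a -/b.
    have kA := key A mA.
    have -> : 1 - a / (1 + a) = (1 + a)^-1 by field; rewrite gt_eqF.
    have -> : 1 - b / (1 + a) = r / (1 + a).
      by have -> : r = 1 + a - b by [rewrite keyT addrK]; field; rewrite gt_eqF.
    have -> : a / (1 + a) * (mass up A / a) = mass up A / (1 + a).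
      by field; rewrite !gt_eqF.
    have -> : b / (1 + a) * (mass dn A / b) = mass dn A / (1 + a).
      by field; rewrite !gt_eqF.
    rewrite -[normal_pdf 0 1]/phi.
    have -> : mass up A / (1 + a) + (1 + a)^-1 * mass phi A =
              (mass phi A + mass up A) / (1 + a) by ring.
    by rewrite kA; ring.
  - by apply: zeroP => //; rewrite F1E// mass_eq0 ?mul0r.
  - by apply: zeroP => //; rewrite F2E// mass_eq0 ?mul0r.
have [M1 M2 M3 M4 M5] := M.
have n1near : n1 (~` far t) != 0%E.
  rewrite -probability_fineK// eqe n1E -mass_normal gt_eqF//.
  apply: (@lt_le_trans _ _ (normal_pdf 0 1 1 * (1 - (-1)))).
    by rewrite mulr_gt0 ?normal_pdf_gt0//; lra.
  have t1 : 1 < t by apply: lt_le_trans t2; rewrite ltr1n.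
  apply: (le_mass_cst sphi nfar).
  - exact: phi0.
  - by apply: (@le_trans _ _ 0); rewrite ?lerN10 ?ler01.
  - move=> z /=; rewrite in_itv/= => /andP[z1 z2]; apply/negP; rewrite -leNgt.
    rewrite ler_norml (ltW (lt_trans z2 t1)) andbT ltW// (lt_trans _ z1)//.
    by rewrite ltrN2.
  - move=> z /andP[z1 z2]; apply: normal_pdf_anti.
    by rewrite expr1n -real_normK ?num_real// expr_le1// ler_norml (ltW z1) (ltW z2).
have n2far : n2 (far t) != 0%E.
  rewrite -probability_fineK// eqe n2E -mass_normal gt_eqF//.
  have : 0 < mass g (far t).
    have pt : 0 < normal_pdf 0 1 (t + 1) :> R by rewrite normal_pdf_gt0.
    apply: (@lt_le_trans _ _ (normal_pdf 0 1 (t + 1) * (t + 1 - t))).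
      by rewrite mulr_gt0// subr_gt0 ltrDl.
    apply: (le_mass_cst sg (mfar t)); first exact: ltW.
    - by rewrite lerDl.
    - by move=> z /=; rewrite in_itv/= => /andP[z1 z2]; rewrite /far/= ltr_normr z1.
    - move=> z /andP[z1 z2]; apply: (@le_trans _ _ (phi z)).
        have z0 : 0 < z := lt_trans t0 z1.
        apply: normal_pdf_anti; rewrite ler_pXn2r ?nnegrE ?(ltW z0) ?(ltW z2)//.
        by rewrite addr_ge0 ?(ltW t0).
      have fz : far t z by rewrite /far/= ltr_normr z1.
      have /= := congr1 (fun h => h z) updn.
      by rewrite (far_dn _ fz) addr0 => <-; rewrite lerDl.
  by rewrite massg// pmulr_rgt0.
exists (MixturePair s0 n1E n2E M1 M2 M3 M4 M5 n1near n2far); split => /=.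
- apply: le_trans a_le; rewrite ler_pdivrMr// ler_peMr ?(ltW a_gt0)//.
  by rewrite lerDl ltW.
- apply: (@le_trans _ _ b).
    by rewrite ler_pdivrMr// ler_peMr ?(ltW b_gt0)// lerDl ltW.
  by have -> : b = 1 + a - r by [rewrite keyT addrC addKr]; lra.
- move=> X tX; have X0 : 0 <= X by rewrite (le_trans _ tX)// ltW.
  have e0 : 0 <= expR (d * (X ^+ 2 - t ^+ 2) / 2) - 1.
    rewrite subr_ge0 expR_ge1 divr_ge0// mulr_ge0 ?(ltW d0)//.
    by rewrite subr_ge0 ler_pXn2r// ?nnegrE// ltW.
  apply: (@le_trans _ _ (mass up (far X))).
    rewrite /normal_tail -mass_normal.
    have sub : `]X, +oo[ `<=` far X.
      by move=> z /=; rewrite in_itv/= andbT /far/= => zX; rewrite ltr_normr zX.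
    apply: (le_mass sphi sup) => //.
    by move=> x /sub fx; exact: up_far.
  rewrite F1E// -/a.
  have -> : 2 * (a / (1 + a) * (mass up (far X) / a)) = mass up (far X) * (2 / (1 + a)).
    by field; rewrite !gt_eqF.
  rewrite ler_peMr ?mass_ge0// ler_pdivlMr// mul1r; lra.
Qed.

(** * Tails of the normal law *)

Lemma normal_tailE {R : realType} (x : R) :
  normal_tail x = mass (normal_pdf 0 1) `]x, +oo[.
Proof. by []. Qed.

Lemma normal_tail_ge0 {R : realType} (x : R) : 0 <= normal_tail x.
Proof. by rewrite normal_tailE mass_ge0// => y; exact: normal_pdf_ge0. Qed.

Lemma normal_tail_anti {R : realType} :
  {homo @normal_tail R : x y / x <= y >-> y <= x}.
Proof.
move=> x y xy; rewrite !normal_tailE -[leLHS]mul1r.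
have sn := @subdensity_normal R 1.
apply: (le_mass sn sn) => //; last by move=> z _; rewrite mul1r.
by move=> z /=; rewrite !in_itv/= !andbT; exact: le_lt_trans.
Qed.

Lemma normal_tail_le {R : realType} (x : R) : 0 <= x ->
  normal_tail x <= Num.sqrt 2 * expR (- (x ^+ 2 / 4)).
Proof.
move=> x0; rewrite normal_tailE.
have s2 : 0 < Num.sqrt 2 :> R by rewrite sqrtr_gt0.
set c := Num.sqrt 2 * _; have c0 : 0 < c by rewrite mulr_gt0 ?expR_gt0.
have sn := @subdensity_normal R 1; have sn2 := @subdensity_normal R (Num.sqrt 2).
have : c^-1 * mass (normal_pdf 0 1) `]x, +oo[ <= mass (normal_pdf 0 (Num.sqrt 2)) setT.
  apply: (le_mass sn sn2) => //; first by rewrite invr_ge0 ltW.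
  move=> z /=; rewrite in_itv/= andbT => xz.
  rewrite mulrC ler_pdivrMr// normal_pdf01E (normal_pdf0E _ s2) sqr_sqrtr//.
  have -> : normal_peak 1 / Num.sqrt 2 * expR (- (z ^+ 2 / 2 / 2)) * c =
     normal_peak 1 * (expR (- (z ^+ 2 / 2 / 2)) * expR (- (x ^+ 2 / 4))).
    by rewrite /c; field; rewrite gt_eqF.
  rewrite ler_wpM2l ?normal_peak_ge0// -expRD ler_expR.
  have : x ^+ 2 <= z ^+ 2 by rewrite ler_pXn2r ?nnegrE ?(ltW xz)// (le_trans x0)// ltW.
  by lra.
by rewrite mass_normalT mulrC ler_pdivrMr// mul1r.
Qed.

(** Makes [2 * normal_tail x] an admissible BH level, that is, at most 1. *)
Lemma normal_tail_le_half {R : realType} (x : R) : 4 <= x -> 2 * normal_tail x <= 1.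
Proof.
move=> x4; have x0 : 0 <= x by rewrite (le_trans _ x4).
have x16 : 16 <= x ^+ 2.
  have -> : 16 = 4 ^+ 2 :> R by rewrite expr2; lra.
  by rewrite ler_pXn2r ?nnegrE.
have h := normal_tail_le x0.
have e : expR (- (x ^+ 2 / 4)) <= 3^-1.
  rewrite expRN lef_pV2 ?posrE ?expR_gt0//.
  by apply: le_trans (expR_ge1Dx _); lra.
have s : Num.sqrt 2 <= 3 / 2 :> R.
  by rewrite -(@ler_pXn2r _ 2)// ?nnegrE ?sqrtr_ge0// sqr_sqrtr//; lra.
have : Num.sqrt 2 * expR (- (x ^+ 2 / 4)) <= 3 / 2 * 3^-1.
  by rewrite ler_pM ?sqrtr_ge0 ?expR_ge0.
by lra.
Qed.

(** Between x and x + 1/x the density is at least its value at the right end, and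
    (x + 1/x)^2 <= x^2 + 3. *)
Lemma normal_tail_ge {R : realType} (x : R) : 1 <= x ->
  normal_peak 1 * expR (- (3 / 2)) * (expR (- (x ^+ 2 / 2)) / x) <= normal_tail x.
Proof.
move=> x1; have x0 : 0 < x by rewrite (lt_le_trans _ x1).
have vx1 : x^-1 <= 1 by rewrite invf_le1.
have vx0 : 0 < x^-1 by rewrite invr_gt0.
have sn := @subdensity_normal R 1.
rewrite normal_tailE.
apply: (@le_trans _ _ (normal_pdf 0 1 (x + x^-1) * (x + x^-1 - x))).
  rewrite addrAC subrr add0r normal_pdf01E.
  have -> : normal_peak 1 * expR (- (3 / 2)) * (expR (- (x ^+ 2 / 2)) / x) =
    normal_peak 1 * (expR (- (3 / 2)) * expR (- (x ^+ 2 / 2))) * x^-1 by ring.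
  rewrite ler_wpM2r ?(ltW vx0)// ler_wpM2l ?normal_peak_ge0// -expRD ler_expR.
  have -> : (x + x^-1) ^+ 2 = x ^+ 2 + 2 + x^-1 ^+ 2.
    by field; rewrite gt_eqF.
  have : x^-1 ^+ 2 <= 1 by rewrite expr_le1// ltW.
  by lra.
apply: (le_mass_cst sn) => //.
- exact: normal_pdf_ge0.
- by rewrite lerDl ltW.
- by move=> z /=; rewrite !in_itv/= andbT => /andP[].
- move=> z /andP[z1 z2]; apply: normal_pdf_anti.
  have z0 : 0 < z := lt_trans x0 z1.
  by rewrite ler_pXn2r ?nnegrE ?(ltW z0) ?(ltW z2)// addr_ge0 ?(ltW x0) ?(ltW vx0).
Qed.

Lemma measurable_set_family {d} {T : measurableType d} {I : finType}
    (b : I -> T -> bool) (U : {set I}) :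
  (forall i, measurable [set y | b i y]) ->
  measurable [set y | [set i | b i y]%SET = U].
Proof.
move=> mb; rewrite (_ : [set y | _] =
  \bigcap_(i in [set: I]) (if i \in U then [set y | b i y] else ~` [set y | b i y])).
  apply: fin_bigcap_measurable => // i _.
  by case: ifP => // _; exact: measurableC.
apply/seteqP; split=> y /=.
  by move=> <- i _; rewrite finset.in_set; case: ifPn => [//|/negP].
move=> h; apply/setP => i; rewrite finset.in_set; have := h i Logic.I.
by case: ifP => iU //= /negP/negbTE.
Qed.

Lemma measurable_pvalue_le {R : realType} {n : nat} (u s c : R) (i : 'I_n) :
  measurable [set y | pvalue y u s i <= c].
Proof.
pose p (x : R) := 2 * normal_tail (`|x - u| / s).
have mp : measurable_fun [set: R] p.
  apply: measurable_funM => //.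
  apply: (measurableT_comp (f := @normal_tail R)); first last.
    apply: measurable_funM => //; apply: measurableT_comp => //.
    exact: measurable_funB.
  apply: nonincreasing_measurable => // x y xy; exact: normal_tail_anti.
have -> : [set y : n.-tuple R | pvalue y u s i <= c] =
    [set: n.-tuple R] `&` (fun y => tnth y i) @^-1` ([set: R] `&` p @^-1` `]-oo, c]).
  apply/seteqP; split=> y; rewrite /= in_itv/= /pvalue /p; last by case=> _ [].
  by [].
apply: measurable_tnth => //; exact: mp.
Qed.

(** * The BH procedure *)

Definition small {R : realType} {n : nat} (y : n.-tuple R) (u s c : R) : {set 'I_n} :=
  [set i | pvalue y u s i <= c].

Lemma sum_pvalue_le {R : realType} {n : nat} (y : n.-tuple R) (u s c : R) :
  \sum_(i < n) (pvalue y u s i <= c)%R%:R =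
  #|small y u s c|%:R :> R.
Proof.
rewrite -sum1_card natr_sum [RHS]big_mkcond/=; apply: eq_bigr => i _.
by rewrite finset.in_set; case: ifP.
Qed.

(** The largest level that satisfies the BH condition when exactly [m] p-values
    are below it. *)
Definition BH_grid {R : realType} (alpha : R) (n m : nat) : R :=
  Num.min 1 (m%:R * alpha / n%:R).

(** The threshold is a supremum over a continuum of levels. If [m] p-values are
    below it then it is at most [BH_grid alpha n m], which is itself a level; so
    finitely many comparisons of p-values with constants decide what is
    rejected, and BH is measurable. *)
Lemma BH_gridP {R : realType} {n : nat} (alpha u s : R) (y : n.-tuple R) (i : 'I_n) :
  (0 < n)%N -> 0 < alpha ->
  (i \in BH alpha y u s) =
  [exists m : 'I_n.+1,
     (m <= #|small y u s (BH_grid alpha n m)|)%N &&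
     (i \in small y u s (BH_grid alpha n m))].
Proof.
move=> n0 a0; have nR : 0 < n%:R :> R by rewrite ltr0n.
have [[/andP[T0 T1] LT] ubT] := BH_threshold_max y u s a0.
rewrite /BH finset.in_set; set T := BH_threshold alpha y u s in T0 T1 LT ubT *.
apply/idP/existsP => [pT|[m]]; last rewrite [i \in _]finset.in_set => /andP[mN pm].
  rewrite sum_pvalue_le in LT.
  pose N := #|small y u s T|.
  have Nn : (N < n.+1)%N by rewrite ltnS -[leqRHS]card_ord max_card.
  have TN : T <= BH_grid alpha n N.
    rewrite /BH_grid le_min T1/= ler_pdivlMr// mulrC.
    by rewrite ler_pdivrMr// in LT.
  exists (Ordinal Nn) => /=; apply/andP; split; last first.
    by rewrite finset.in_set; exact: le_trans TN.
  apply: subset_leq_card; apply/fintype.subsetP => j; rewrite !finset.in_set.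
  by move=> /le_trans; apply.
apply: (le_trans pm); apply: ubT; split.
  rewrite /BH_grid ge_min lexx/= le_min ler01/= divr_ge0// ?mulr_ge0// ?(ltW a0)//.
rewrite sum_pvalue_le; apply: (@le_trans _ _ m%:R); last by rewrite ler_nat.
rewrite ler_pdivrMr// mulrC -ler_pdivlMr// /BH_grid.
by rewrite ge_min lexx orbT.
Qed.

Lemma measurable_BH {R : realType} {n : nat} (alpha u s : R) (D : set {set 'I_n}) :
  (0 < n)%N -> 0 < alpha -> measurable [set y | D (BH alpha y u s)].
Proof.
move=> n0 a0.
pose b (k : 'I_n * 'I_n.+1) (y : n.-tuple R) :=
  pvalue y u s k.1 <= BH_grid alpha n k.2.
pose F (U : {set 'I_n * 'I_n.+1}) : {set 'I_n} :=
  [set i | [exists m : 'I_n.+1, (m <= #|[set j | (j, m) \in U]%SET|)%N &&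
                                ((i, m) \in U)]]%SET.
have FE y : BH alpha y u s = F [set k | b k y]%SET.
  apply/setP => i; rewrite BH_gridP// finset.in_set; apply: eq_existsb => m.
  rewrite !finset.in_set; congr (_ && _); congr (_ <= _)%N.
  by apply: eq_card => j; rewrite !finset.in_set.
have -> : [set y | D (BH alpha y u s)] = [set y | (D \o F) [set k | b k y]%SET].
  by apply/seteqP; split=> y /=; rewrite FE.
apply: (measurable_finite_preimage (Z := fun y => [set k | b k y]%SET) (D \o F)).
move=> U; apply: measurable_set_family => k; exact: measurable_pvalue_le.
Qed.

(** As many observations beyond [X] as [A] has make the p-value of [X] an
    admissible level, hence a lower bound of the threshold. *)
Lemma BH_reject {R : realType} {n : nat} (alpha X : R) (y : n.-tuple R)
    (A : {set 'I_n}) :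
  0 < alpha -> 4 <= X -> (forall i, i \in A -> X < `|tnth y i|) ->
  n%:R * (2 * normal_tail X) / alpha <= #|A|%:R ->
  A \subset BH alpha y 0 1.
Proof.
move=> a0 X4 far nA.
have [_ ubT] := BH_threshold_max y 0 1 a0.
have pX i : i \in A -> pvalue y 0 1 i <= 2 * normal_tail X.
  move=> /far Xi; rewrite /pvalue subr0 divr1 ler_pM2l//.
  by apply: normal_tail_anti; exact: ltW.
apply/fintype.subsetP => i iA; rewrite /BH finset.in_set; apply: (le_trans (pX _ iA)).
apply: ubT; split.
  by rewrite mulr_ge0 ?normal_tail_ge0//= normal_tail_le_half.
apply: (le_trans nA); rewrite sum_pvalue_le ler_nat.
by apply: subset_leq_card; apply/fintype.subsetP => j /pX; rewrite finset.in_set.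
Qed.

(** * Silence of the procedure and power of the oracle *)

Lemma cell_fdr_le1 {R : realType} {n : nat} (P : product_law R n)
    (rej : n.-tuple R -> {set 'I_n}) (B : set R) (S : {set 'I_n}) :
  testing_procedure rej -> measurable B -> cell_fdr P rej B S <= 1.
Proof.
move=> mrej mB; have mcell z : measurable [set y | cell rej B y = z].
  exact: measurable_cell.
have <- : \sum_z fine (P [set y | cell rej B y = z]) = 1.
  rewrite -(prob_finite_map P (Z := cell rej B) xpredT)//.
  rewrite (_ : [set y | _] = setT); last by apply/seteqP; split.
  by rewrite probability_setT.
apply: ler_sum => z _; have /andP[P0 _] := fine_prob01 P (mcell z).
rewrite ler_piMl// ler_pdivrMr ?ltr0n ?leq_max ?orbT// mul1r ler_nat leq_max.
by rewrite subset_leq_card// finset.subsetIl.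
Qed.

Lemma weighted_sum_le {R : realType} {I : finType} (w v : I -> R) (good : pred I)
    (c : R) :
  (forall i, 0 <= w i) -> \sum_i w i = 1 -> 0 <= c ->
  (forall i, v i <= 1) -> (forall i, good i -> v i <= c) ->
  \sum_i w i * v i <= c + \sum_(i | ~~ good i) w i.
Proof.
move=> w0 w1 c0 v1 vc; rewrite -[X in _ <= X + _]mul1r -w1 mulr_suml.
rewrite [X in _ <= _ + X]big_mkcond/= -big_split/=; apply: ler_sum => i _.
case: ifPn => [_|/negPn gi]; last by rewrite addr0 ler_wpM2l// vc.
by rewrite -[leLHS]add0r lerD ?mulr_ge0// ler_piMr.
Qed.

Lemma weighted_sum_ex {R : realType} {I : finType} (w v : I -> R) (good : pred I)
    (c e b : R) :
  (forall i, 0 <= w i) -> \sum_i w i = 1 -> (forall i, 0 <= v i) ->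
  \sum_i w i * v i <= e -> \sum_(i | ~~ good i) w i <= b -> e < c * (1 - b) ->
  0 <= c -> exists2 i, good i & v i <= c.
Proof.
move=> w0 w1 v0 we wb ecb c0; apply: contrapT => no.
have vc i : good i -> c <= v i.
  move=> gi; rewrite leNgt; apply/negP => vic.
  by apply: no; exists i => //; exact: ltW.
move: ecb; apply/negP; rewrite -leNgt; apply: le_trans we.
apply: (@le_trans _ _ (\sum_(i | good i) w i * v i)); last first.
  rewrite big_mkcond/=; apply: ler_sum => i _.
  by case: ifP => // _; rewrite mulr_ge0.
apply: (@le_trans _ _ (\sum_(i | good i) w i * c)); last first.
  by apply: ler_sum => i gi; rewrite ler_wpM2l// vc.
rewrite -mulr_suml mulrC ler_wpM2r//.
by have := w1; rewrite (bigID good)/= => <-; lra.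
Qed.

(** FDR control bounds both averages of [testing_tradeoff], up to the sets of
    alternatives that are too large, whose weight is small by Markov's
    inequality. So on average over [S], in the first model, something is
    rejected with probability at most 1/4; some [S] of typical size does no
    worse than 3/5. *)
Lemma silent_alternative {R : realType} {n : nat} (t k1 k2 : R)
    (M : mixture_pair t) (rej : n.-tuple R -> {set 'I_n}) :
  0 < k1 -> k1 <= k2 -> k2 < n%:R / 2 ->
  n%:R * freq1 M <= k1 / 40 -> n%:R * freq2 M <= k2 / 20 ->
  expR (- (n%:R * freq1 M / 4)) <= 40^-1 ->
  testing_procedure rej ->
  (forall P : product_law R n, has_null P -> (n1 P)%:R <= k2 ->
     (FDR P rej <= (20^-1)%:E)%E) ->
  exists (P : product_law R n) (S : {set 'I_n}),
    [/\ has_null P, null_param P = (0, 1), H1 P = S,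
        forall i, margin P i = if i \in S then alt1 M else null1 M &
        [/\ n%:R * freq1 M / 4 <= #|S|%:R, #|S|%:R <= k1 &
            2 / 5 <= fine (P [set y | rej y = finset.set0])]].
Proof.
move=> k10 k12 k2n np1 np2 e40 mrej fdr.
have num1 : 20^-1 + 40^-1 + (20^-1 + 20^-1) <= 1 / 4 :> R by lra.
have num2 : 1 / 4 < 3 / 5 * (1 - (40^-1 + 40^-1)) :> R by lra.
have num3 (v : R) : v <= 3 / 5 -> 2 / 5 + v <= 1 by lra.
have k20 : 0 < k2 := lt_le_trans k10 k12.
have [P1 M1] := choice (fun S : {set 'I_n} =>
  product_law_ex (fun i => if i \in S then alt1 M else null1 M)).
have [P2 M2] := choice (fun S : {set 'I_n} =>
  product_law_ex (fun i => if i \in S then alt2 M else null2 M)).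
have {}M1 S i : margin (P1 S) i = if i \in S then alt1 M else null1 M by rewrite M1.
have {}M2 S i : margin (P2 S) i = if i \in S then alt2 M else null2 M by rewrite M2.
have mfar : measurable (far t : set R) := measurable_far t.
have mB : measurable (~` far t) := measurableC mfar.
have N1 (S : {set 'I_n}) : #|S|%:R <= k2 ->
    [/\ has_null (P1 S), null_param (P1 S) = (0, 1), H1 (P1 S) = S &
        H0 (P1 S) = ~: S].
  move=> Sk; apply: (null_model ltr01 (null1E M) mB _ (M1 S)).
    by rewrite alt1_near => /esym /eqP; rewrite (negbTE (null1_near M)).
  exact: le_lt_trans k2n.
have N2 (S : {set 'I_n}) : #|S|%:R <= k2 ->
    [/\ has_null (P2 S), null_param (P2 S) = (0, sd2 M), H1 (P2 S) = S &
        H0 (P2 S) = ~: S].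
  move=> Sk; apply: (null_model (sd2_gt0 M) (null2E M) mfar _ (M2 S)).
    by rewrite alt2_far => /esym /eqP; rewrite (negbTE (null2_far M)).
  exact: le_lt_trans k2n.
pose B : set R := ~` far t.
have f2B : alt2 M (~` B) = 0%E by rewrite setCK alt2_far.
have := testing_tradeoff (freq1_01 M) (freq2_01 M) M1 M2 (mixtureE M) mB
  (alt1_near M) f2B mrej.
move=> tradeoff.
have q1 (i : 'I_n) := freq1_01 M; have q2 (i : 'I_n) := freq2_01 M.
have fdr1 (S : {set 'I_n}) : #|S|%:R <= k1 -> cell_fdr (P1 S) rej B S <= 20^-1.
  move=> Sk; have [hn _ H1S H0S] := N1 S (le_trans Sk k12).
  rewrite -lee_fin -(FDR_cell mrej mB H0S); apply: fdr => //.
  by rewrite /n1 H1S (le_trans Sk k12).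
have fdr2 (S : {set 'I_n}) : #|S|%:R <= k2 -> cell_fdr (P2 S) rej B S <= 20^-1.
  move=> Sk; have [hn _ H1S H0S] := N2 S Sk.
  rewrite -lee_fin -(FDR_cell mrej mB H0S); apply: fdr => //.
  by rewrite /n1 H1S.
have bad1 : \sum_(S : {set 'I_n} | ~~ (#|S|%:R <= k1)) bern (fun=> freq1 M) S <= 40^-1.
  under eq_bigl => S do rewrite -ltNge.
  apply: (le_trans (bern_markov q1 k10)).
  by rewrite sumr_const card_ord -[freq1 M *+ n]mulr_natl ler_pdivrMr// [leRHS]mulrC.
have bad2 : \sum_(S : {set 'I_n} | ~~ (#|S|%:R <= k2)) bern (fun=> freq2 M) S <= 20^-1.
  under eq_bigl => S do rewrite -ltNge.
  apply: (le_trans (bern_markov q2 k20)).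
  by rewrite sumr_const card_ord -[freq2 M *+ n]mulr_natl ler_pdivrMr// [leRHS]mulrC.
have avg1 : \sum_S bern (fun=> freq1 M) S * cell_fdr (P1 S) rej B S <= 20^-1 + 40^-1.
  apply: le_trans (lerD (lexx _) bad1).
  apply: weighted_sum_le => //.
  - by move=> S; exact: bern_ge0.
  - exact: sum_bern.
  - by move=> S; exact: cell_fdr_le1.
have avg2 : \sum_S bern (fun=> freq2 M) S * cell_fdr (P2 S) rej B S <= 20^-1 + 20^-1.
  apply: le_trans (lerD (lexx _) bad2).
  apply: weighted_sum_le => //.
  - by move=> S; exact: bern_ge0.
  - exact: sum_bern.
  - by move=> S; exact: cell_fdr_le1.
pose good (S : {set 'I_n}) : bool :=
  (n%:R * freq1 M / 4 <= #|S|%:R) && (#|S|%:R <= k1).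
have bad : \sum_(S : {set 'I_n} | ~~ good S) bern (fun=> freq1 M) S <= 40^-1 + 40^-1.
  have small : \sum_(S : {set 'I_n} | #|S|%:R < n%:R * freq1 M / 4) bern (fun=> freq1 M) S
      <= 40^-1.
    have := bern_lower_tail q1; rewrite sumr_const card_ord -[freq1 M *+ n]mulr_natl => h.
    exact: le_trans h e40.
  apply: le_trans (lerD small bad1).
  rewrite big_mkcond/= [X in _ <= X + _]big_mkcond/= [X in _ <= _ + X]big_mkcond/=.
  rewrite -big_split/=; apply: ler_sum => S _.
  have b0 : 0 <= bern (fun=> freq1 M) S by exact: bern_ge0.
  rewrite /good negb_and -ltNge.
  by case: (_ < _); case: (_ <= k1) => /=; rewrite ?addr0 ?add0r ?lerDl.
have mne : measurable [set y | rej y != finset.set0].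
  exact: (measurable_finite_preimage (fun S => S != finset.set0)).
have m0 : measurable [set y | rej y = finset.set0] by exact: mrej.
have [|||||||S /andP[S1 S2] Sv] := @weighted_sum_ex R {set 'I_n} (bern (fun=> freq1 M))
    (fun S => fine (P1 S [set y | rej y != finset.set0])) good
    (3 / 5) (1 / 4) (40^-1 + 40^-1).
- by move=> S; exact: bern_ge0.
- exact: sum_bern.
- by move=> S; have /andP[] := fine_prob01 (P1 S) mne.
- by apply: (le_trans tradeoff); exact: (le_trans (lerD avg1 avg2)).
- exact: bad.
- exact: num2.
- by rewrite divr_ge0.
have [hn np H1S _] := N1 S (le_trans S2 k12).
exists (P1 S), S; split=> //; split=> //.
have -> : [set y | rej y = finset.set0] = ~` [set y | rej y != finset.set0].
  by apply/seteqP; split=> y /=; [move=> ->; rewrite eqxx|move/negP/negPn/eqP].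
rewrite probability_setC// fineB ?fin_num_measure//= lerBrDr.
exact: num3.
Qed.

(** The number of alternatives beyond [X] is a sum of independent indicators of
    mean |S| f(|x| > X). It is rarely below a quarter of its mean, and otherwise
    [BH_reject] applies to these alternatives alone. *)
Lemma oracle_power {R : realType} {n : nat} (P : product_law R n) (S : {set 'I_n})
    (f nu : probability R R) (alpha X m : R) :
  (0 < n)%N -> 0 < alpha -> 4 <= X ->
  null_param P = (0, 1) -> H1 P = S ->
  (forall i, margin P i = if i \in S then f else nu) ->
  n%:R * (2 * normal_tail X) / alpha <= #|S|%:R * fine (f (far X)) / 4 ->
  m <= #|S|%:R * fine (f (far X)) / 4 ->
  ((1 - expR (- m))%:E <= P [set y | m <= #|oracle_BH P alpha y :&: H1 P|%:R]%R)%E.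
Proof.
move=> n0 a0 X4 np H1S Mg; set Q := #|S|%:R * _ => nQ mQ.
(* nothing is counted at a coordinate outside [S] *)
pose A i : set R := if i \in S then far X else set0.
have mA i : measurable (A i).
  by rewrite /A; case: ifP => // _; exact: measurable_far.
have QE : \sum_(i < n) fine (margin P i (A i)) = Q.
  rewrite /Q -sum1_card natr_sum mulr_suml [RHS]big_mkcond/=.
  apply: eq_bigr => i _; rewrite Mg /A; case: ifP => _; first by rewrite mul1r.
  by rewrite measure0.
have tail := hits_lower_tail mA QE.
have mhit (D : set {set 'I_n}) : measurable [set y | D (hits A y)].
  by apply: measurable_finite_preimage => U; exact: measurable_hits.
have mlow : measurable [set y : n.-tuple R | #|hits A y|%:R < Q / 4].
  exact: (mhit (fun U => #|U|%:R < Q / 4)).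
have mE : measurable [set y | m <= #|oracle_BH P alpha y :&: H1 P|%:R].
  rewrite /oracle_BH; set u := theta P; set s := sigma P.
  exact: (measurable_BH u s (fun U => m <= #|U :&: H1 P|%:R) n0 a0).
apply: (@le_trans _ _ (P (~` [set y | #|hits A y|%:R < Q / 4]))).
  rewrite probability_setC// -(probability_fineK P mlow) -EFinB lee_fin lerD2l lerN2.
  by apply: (le_trans tail); rewrite ler_expR lerN2.
apply: le_measure; rewrite ?inE//; first exact: measurableC.
move=> y /= /negP; rewrite -leNgt => hy; apply: (le_trans mQ); apply: (le_trans hy).
rewrite ler_nat; apply: subset_leq_card.
have hS : hits A y \subset S.
  apply/fintype.subsetP => i; rewrite finset.in_set /A; case: ifP => // _ /asboolP [].
rewrite finset.subsetI H1S hS andbT /oracle_BH /theta /sigma np/=.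
apply: (@BH_reject _ _ _ X) => //; last exact: le_trans hy.
by move=> i; rewrite finset.in_set /A; case: ifP => _ /asboolP.
Qed.

(** Silence and a discovery by the oracle have joint probability at least
    2/5 + 4/5 - 1, and together they make the oracle strictly better. *)
Lemma risk_II_ge {R : realType} {n : nat} (P : product_law R n)
    (rej : n.-tuple R -> {set 'I_n}) (k alpha m : R) :
  (0 < n)%N -> 0 < alpha -> 0 < m -> testing_procedure rej ->
  has_null P -> (n1 P)%:R <= k ->
  ((2 / 5)%:E <= P [set y | #|rej y :&: H1 P| = 0%N])%E ->
  ((4 / 5)%:E <= P [set y | m <= #|oracle_BH P alpha y :&: H1 P|%:R]%R)%E ->
  ((1 / 5)%:E <= risk_II rej k alpha)%E.
Proof.
move=> n0 a0 m0 mrej hn nk pr pb.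
set E1 := [set y | _] in pr; set E2 := [set y | _] in pb.
pose E := [set y | TDP P (rej y) < TDP P (oracle_BH P alpha y)].
have mZ D : measurable [set y | D (rej y, oracle_BH P alpha y)].
  apply: (measurable_finite_preimage (Z := fun y => (rej y, oracle_BH P alpha y))).
  case=> T U; rewrite (_ : [set y | _] = [set y | rej y = T] `&`
      [set y | oracle_BH P alpha y = U]).
    apply: measurableI; first exact: mrej.
    rewrite /oracle_BH; set u := theta P; set s := sigma P.
    exact: (measurable_BH u s (fun V => V = U) n0 a0).
  by apply/seteqP; split=> y /= [-> ->].
have mE1 : measurable E1 by exact: (mZ (fun z => #|z.1 :&: H1 P| = 0%N)).
have mE2 : measurable E2 by exact: (mZ (fun z => m <= #|z.2 :&: H1 P|%:R)).
have mE : measurable E by exact: (mZ (fun z => TDP P z.1 < TDP P z.2)).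
have sub : ~` E `<=` ~` E1 `|` ~` E2.
  move=> y; rewrite -setCI => nE [/= e1 e2]; apply: nE; rewrite /E/= /TDP e1 mul0r.
  apply: divr_gt0; last by rewrite ltr0n leq_max orbT.
  exact: lt_le_trans e2.
apply: (@le_trans _ _ (P E)); last by apply: ereal_sup_ubound; exists P.
have le1 : (P (~` E) <= P (~` E1) + P (~` E2))%E.
  apply: (le_trans _ (measureU2 _ _ _)); try exact: measurableC.
  apply: le_measure; rewrite ?inE//; first exact: measurableC.
  by apply: measurableU; exact: measurableC.
move: le1 pr pb; rewrite !probability_setC//.
rewrite -(probability_fineK P mE) -(probability_fineK P mE1) -(probability_fineK P mE2).
by rewrite -!EFinB -EFinD !lee_fin; lra.
Qed.

(** * Choice of the parameters *)

Lemma ln2_ge_half {R : realType} : 1 / 2 <= ln 2 :> R.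
Proof.
rewrite -(expRK (1 / 2)) ler_ln ?posrE ?expR_gt0//.
have h : 1 / 2 <= expR (- (1 / 2)) :> R by apply: le_trans (expR_ge1Dx _); lra.
rewrite -(invrK (expR _)) -expRN -[leRHS]invrK lef_pV2 ?posrE ?expR_gt0 ?invr_gt0//.
by move: h; rewrite div1r.
Qed.

Lemma expRN_le_inv {R : realType} (x : R) : 0 <= x -> expR (- x) <= (1 + x)^-1.
Proof.
by move=> x0; rewrite expRN lef_pV2 ?posrE ?expR_gt0 ?ltr_pwDl// expR_ge1Dx.
Qed.

(** From ln x = 2 ln (sqrt x) <= 2 sqrt x. *)
Lemma sqrt_div_ln_large {R : realType} (c x : R) : 0 < c ->
  3 + 4 * (39 / c) ^+ 4 <= x -> 39 / c <= Num.sqrt (x / ln x).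
Proof.
move=> c0 hx; set b := 39 / c in hx *.
have b0 : 0 < b by rewrite divr_gt0.
have b4 : 0 < b ^+ 4 by rewrite exprn_gt0.
have x3 : 3 <= x by lra.
have x0 : 0 < x by lra.
have lx : 0 < ln x by apply: ln_gt0; lra.
set s := Num.sqrt x; have s0 : 0 < s by rewrite sqrtr_gt0.
have s2 : s ^+ 2 = x by rewrite sqr_sqrtr// ltW.
have lnx : ln x <= 2 * s.
  rewrite -s2 lnXn// mulr_natl ler_pMn2r//.
  by have := expR_ge1Dx (ln s); rewrite lnK ?posrE//; lra.
have sb : 2 * b ^+ 2 <= s.
  have b2 : 0 <= 2 * b ^+ 2 by rewrite mulr_ge0 ?sqr_ge0.
  rewrite -(@ler_pXn2r _ 2)// ?nnegrE ?(ltW s0) ?b2//.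
  by rewrite s2 exprMn -exprM expr2; lra.
have -> : b = Num.sqrt (b ^+ 2) by rewrite sqrtr_sqr gtr0_norm.
rewrite ler_sqrt ?divr_ge0 ?(ltW x0) ?(ltW lx)//.
rewrite ler_pdivlMr//; apply: (@le_trans _ _ (b ^+ 2 * (2 * s))).
  by rewrite ler_wpM2l ?sqr_ge0.
rewrite -s2 expr2 mulrA ler_wpM2r ?(ltW s0)//.
by rewrite mulrC.
Qed.

Lemma normal_tail_sqrt_ln {R : realType} (x : R) : 1 < x -> 1 <= Num.sqrt (ln x) ->
  normal_peak 1 * expR (- (3 / 2)) * Num.sqrt (x / ln x) <=
  x * normal_tail (Num.sqrt (ln x)).
Proof.
move=> x1 X1; have x0 : 0 < x by rewrite (lt_trans _ x1).
have lx : 0 < ln x by exact: ln_gt0.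
set X := Num.sqrt (ln x) in X1 *; have X0 : 0 < X by rewrite sqrtr_gt0.
have sx0 : 0 < Num.sqrt x by rewrite sqrtr_gt0.
have := normal_tail_ge X1; rewrite {1}/X sqr_sqrtr ?(ltW lx)// => tail.
apply: (@le_trans _ _ (x * (normal_peak 1 * expR (- (3 / 2)) *
   (expR (- (ln x / 2)) / X)))); last by rewrite ler_wpM2l ?(ltW x0).
have -> : expR (- (ln x / 2)) = (Num.sqrt x)^-1.
  rewrite expRN; congr (_^-1); apply/eqP; rewrite -(@eqrXn2 _ 2)// ?expR_ge0 ?sqrtr_ge0//.
  rewrite sqr_sqrtr ?(ltW x0)// -expRM_natl.
  by have -> : 2%:R * (ln x / 2) = ln x by [field]; rewrite lnK ?posrE.
rewrite sqrtrM ?(ltW x0)// sqrtrV ?(ltW lx)// -/X.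
have -> : x * (normal_peak 1 * expR (- (3 / 2)) * ((Num.sqrt x)^-1 / X)) =
   normal_peak 1 * expR (- (3 / 2)) * (x / Num.sqrt x * X^-1).
  by field; rewrite !gt_eqF.
have -> : x / Num.sqrt x = Num.sqrt x.
  by rewrite -[X in X / _](sqr_sqrtr (ltW x0)) expr2 mulfK ?gt_eqF.
by [].
Qed.

(** Let L = 1 + ln (k2 / k1), t^2 = 16 L and d = k2 / (320 N L). Then d t^2 / 2
    is k2 / (40 N), and exp(-t^2/16) = exp(-L) turns a multiple of d into a
    multiple of k1 / N: these are the two proportions of alternatives. Beyond
    X = sqrt (ln N) the alternatives outnumber the nulls by a factor of order
    exp(d X^2 / 2), where d X^2 / 2 = k2 ln N / (640 N L) is at least
    129 ln (2 / alpha) by the lower bound on [k2]. *)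
Lemma design_ex {R : realType} (N alpha k1 k2 : R) :
  1 < N -> 0 < alpha < 1 -> 0 < k1 -> k1 <= k2 ->
  640 * 129 * (N * ln (2 / alpha) / ln N) * (1 + ln (k2 / k1)) <= k2 ->
  k2 < N / 2 ->
  exists (t : R) (M : mixture_pair t),
    let X := Num.sqrt (ln N) in
    [/\ 4 <= X, N * freq1 M <= k1 / 40, N * freq2 M <= k2 / 20 &
        128 / alpha * normal_tail X <= 2 * (freq1 M * fine (alt1 M (far X)))].
Proof.
move=> N1 /andP[a0 a1] k10 k12 H k2N.
have N0 : 0 < N by rewrite (lt_trans _ N1).
have k20 : 0 < k2 := lt_le_trans k10 k12.
set l := ln N in H *; have l0 : 0 < l by exact: ln_gt0.
set la := ln (2 / alpha) in H.
set L := 1 + ln (k2 / k1) in H.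
have L1 : 1 <= L by rewrite lerDl ln_ge0// ler_pdivlMr// mul1r.
have L0 : 0 < L by rewrite (lt_le_trans _ L1).
have ia : 1 <= alpha^-1 by rewrite invf_ge1// ltW.
have la2 : 1 / 2 <= la.
  apply: (le_trans ln2_ge_half); rewrite ler_ln ?posrE ?divr_gt0//.
  by rewrite ler_peMr.
have la0 : 0 < la by lra.
have H' : 640 * 129 * la <= k2 * l / (N * L).
  rewrite ler_pdivlMr ?mulr_gt0//.
  have := ler_wpM2r (ltW l0) H.
  have -> : 640 * 129 * (N * la / l) * L * l = 640 * 129 * la * (N * L).
    by field; rewrite gt_eqF.
  by [].
have lL : 16 * L <= l.
  have h : 640 * 129 * la <= 1 / 2 * (l / L).
    apply: (le_trans H'); have -> : k2 * l / (N * L) = k2 / N * (l / L).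
      by field; rewrite !gt_eqF.
    rewrite ler_wpM2r ?divr_ge0 ?ltW// ltr_pdivrMr//.
    by move: k2N; lra.
  by rewrite -ler_pdivlMr//; lra.
have NL0 : 0 < N * L by rewrite mulr_gt0.
pose d := k2 / (N * L) / 320; pose t := Num.sqrt (16 * L).
have t2 : t ^+ 2 = 16 * L by rewrite sqr_sqrtr// mulr_ge0// ltW.
have d0 : 0 < d by apply: divr_gt0; [exact: divr_gt0|rewrite ltr0n].
have NL : N <= N * L by rewrite ler_peMr// ltW.
have d12 : d <= 12^-1.
  have h : k2 / (N * L) <= 1 by rewrite ler_pdivrMr// mul1r; lra.
  by rewrite /d; lra.
have t4 : 4 <= t.
  rewrite -(@ler_pXn2r _ 2)// ?nnegrE ?sqrtr_ge0// t2 expr2.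
  by lra.
have tX : t <= Num.sqrt l by rewrite /t ler_sqrt ?(ltW l0).
have d012 : 0 < d <= 12^-1 by rewrite d0.
have t2' : 2 <= t by lra.
have [M [Mp1 Mp2 Mtail]] := mixture_pair_ex d012 t2'.
exists t, M => X.
have eL : expR (- (t ^+ 2 / 16)) <= 2^-1 * (k1 / k2).
  have -> : t ^+ 2 / 16 = L by rewrite t2; field.
  rewrite /L opprD expRD expRN [expR (- ln _)]expRN lnK ?posrE ?divr_gt0// invf_div.
  rewrite ler_wpM2r ?divr_ge0 ?(ltW k10) ?(ltW k20)// lef_pV2 ?posrE ?expR_gt0//.
  by apply: le_trans (expR_ge1Dx _); lra.
have Na : N * (12 * d * expR (- (t ^+ 2 / 16))) <= 6 / 320 * k1.
  apply: (@le_trans _ _ (N * (12 * d * (2^-1 * (k1 / k2))))).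
    by rewrite ler_wpM2l ?(ltW N0)// ler_wpM2l// mulr_ge0// ltW.
  have -> : N * (12 * d * (2^-1 * (k1 / k2))) = 6 / 320 * k1 / L.
    by rewrite /d; field; rewrite !gt_eqF.
  have kL : k1 / L <= k1 by rewrite ler_pdivrMr// ler_peMr// ltW.
  by move: kL; rewrite -mulrA; lra.
have Nd : N * (d * t ^+ 2 / 2) = k2 / 40.
  by rewrite t2 /d; field; rewrite !gt_eqF.
split.
- exact: le_trans tX.
- apply: (le_trans (ler_wpM2l (ltW N0) Mp1)); apply: (le_trans Na); lra.
- apply: (le_trans (ler_wpM2l (ltW N0) Mp2)); rewrite mulrDr Nd.
  by move: Na; lra.
apply: (le_trans _ (Mtail _ tX)); rewrite ler_wpM2r ?normal_tail_ge0//.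
rewrite t2 sqr_sqrtr ?(ltW l0)//.
(* of the 129 copies of [la], one produces the factor 2 / alpha; the others are
   each at least 1/2 and supply a numerical factor *)
have expo : la + 127 / 2 <= d * (l - 16 * L) / 2.
  have -> : d * (l - 16 * L) / 2 = k2 * l / (N * L) / 640 - k2 / N / 40.
    by rewrite /d; field; rewrite !gt_eqF.
  have : k2 / N <= 1 / 2 by rewrite ler_pdivrMr//; move: k2N; lra.
  by move: H'; lra.
apply: (@le_trans _ _ (expR (la + 127 / 2) - 1)); last by rewrite lerD2r ler_expR.
rewrite expRD lnK ?posrE ?divr_gt0//.
apply: (@le_trans _ _ (2 / alpha * (1 + 127 / 2) - 1)); last first.
  by rewrite lerD2r ler_wpM2l ?divr_ge0 ?(ltW a0)// expR_ge1Dx.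
by lra.
Qed.

(** * The procedure misses what the oracle finds *)

Theorem theorem3p1 (R : realType) :
  exists c1 c2 c3 c4 c5 : R,
  [/\ 0 < c1, 0 < c2, 0 < c3, 0 < c4 & 0 < c5] /\
  forall (n : nat) (alpha : R), c1 <= n%:R -> 0 < alpha < 1 ->
  forall k1 k2 : R, 0 < k1 -> 0 < k2 -> k1 <= k2 ->
    c2 * (n%:R * ln (2 / alpha) / ln n%:R) * (1 + ln (k2 / k1)) <= k2 ->
    k2 < n%:R / 2 ->
  forall rej : n.-tuple R -> {set 'I_n}, testing_procedure rej ->
    ((forall P : product_law R n, has_null P -> (n1 P)%:R <= k2 ->
        (FDR P rej <= c3%:E)%E) ->
     exists P : product_law R n,
       [/\ has_null P, (n1 P)%:R <= k1,
           ((2 / 5)%:E <= P [set y | #|rej y :&: H1 P| = 0%N])%E,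
           ((1 - expR (- (c5 * alpha^-1 * Num.sqrt (n%:R / ln n%:R))))%:E
            <= P [set y | c4 * alpha^-1 * Num.sqrt (n%:R / ln n%:R)
                          <= #|oracle_BH P (alpha / 2) y :&: H1 P|%:R]%R)%E
         & 4 / 5 <= 1 - expR (- (c5 * alpha^-1
                                 * Num.sqrt (n%:R / ln n%:R)))])
    /\ ((risk_I rej k2 <= c3%:E)%E ->
        ((1 / 5)%:E <= risk_II rej k1 (alpha / 2))%E).
Proof.
pose kappa : R := normal_peak 1 * expR (- (3 / 2)).
have kappa0 : 0 < kappa by rewrite mulr_gt0 ?expR_gt0// normal_peak_gt0.
pose c4 : R := 4 * kappa.
have c40 : 0 < c4 by rewrite mulr_gt0.
(* the first constant makes exp(-c4 sqrt (n / ln n)) at most 1/40 *)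
exists (3 + 4 * (39 / c4) ^+ 4), (640 * 129), 20^-1, c4, c4; split.
  have b0 : 0 < 39 / c4 by apply: divr_gt0; rewrite ?ltr0n.
  split.
  - by apply: addr_gt0; [rewrite ltr0n|apply: mulr_gt0; [rewrite ltr0n|exact: exprn_gt0]].
  - by apply: mulr_gt0; rewrite ltr0n.
  - by rewrite invr_gt0 ltr0n.
  - exact: c40.
  - exact: c40.
move=> n alpha c1n a01 k1 k2 k10 k20 k12 H k2n rej mrej.
have /andP[a0 a1] := a01.
set N : R := n%:R in c1n H k2n *; set w := Num.sqrt (N / ln N).
have w39 : 39 / c4 <= w by exact: sqrt_div_ln_large.
have N1 : 1 < N.
  apply: lt_le_trans c1n; apply: (@lt_le_trans _ _ 3); first by rewrite ltr1n.
  by rewrite lerDl mulr_ge0// exprn_even_ge0.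
have n0 : (0 < n)%N by rewrite -(ltr0n R) (lt_trans _ N1).
have w0 : 0 <= w by rewrite sqrtr_ge0.
have ia : 1 <= alpha^-1 by rewrite invf_ge1// ltW.
have cw39 : 39 <= c4 * w by rewrite mulrC -ler_pdivrMr.
have cwa : c4 * w <= c4 * alpha^-1 * w.
  by rewrite ler_wpM2r// ler_peMr// ltW.
have small (x : R) : c4 * w <= x -> expR (- x) <= 40^-1.
  move=> hx; have x39 : 39 <= x := le_trans cw39 hx.
  have x0 : 0 <= x by apply: le_trans x39.
  apply: (le_trans (expRN_le_inv x0)).
  by rewrite lef_pV2 ?posrE ?ltr_pwDl//; move: x39; lra.
have tail45 : 4 / 5 <= 1 - expR (- (c4 * alpha^-1 * w)).
  by have := small _ cwa; lra.
have ah0 : 0 < alpha / 2 by rewrite divr_gt0.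
suff part1 : (forall P : product_law R n, has_null P -> (n1 P)%:R <= k2 ->
        (FDR P rej <= (20^-1)%:E)%E) ->
     exists P : product_law R n,
       [/\ has_null P, (n1 P)%:R <= k1,
           ((2 / 5)%:E <= P [set y | #|rej y :&: H1 P| = 0%N])%E,
           ((1 - expR (- (c4 * alpha^-1 * w)))%:E
            <= P [set y | c4 * alpha^-1 * w
                          <= #|oracle_BH P (alpha / 2) y :&: H1 P|%:R]%R)%E
         & 4 / 5 <= 1 - expR (- (c4 * alpha^-1 * w))].
  split; first exact: part1.
  move=> risk; have [|P [hn nk pr pb _]] := part1.
    move=> P hn nk; apply: le_trans risk.
    by apply: ereal_sup_ubound; exists P.
  apply: (@risk_II_ge _ _ P rej k1 _ (c4 * alpha^-1 * w)) => //.
    by apply: lt_le_trans cwa; apply: lt_le_trans cw39.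
  by apply: le_trans pb; rewrite lee_fin.
move=> fdr.
have [t [M [X4 Np1 Np2 power]]] := design_ex N1 a01 k10 k12 H k2n.
set X := Num.sqrt (ln N) in X4 power.
have X1 : 1 <= X by apply: le_trans X4; rewrite ler1n.
have tailX : kappa * w <= N * normal_tail X by exact: normal_tail_sqrt_ln.
set q := fine (alt1 M (far X)) in power.
have /andP[q0 q1] : 0 <= q <= 1 by apply: fine_prob01; exact: measurable_far.
have /andP[p0 _] := freq1_01 M.
have N0 : 0 < N by rewrite (lt_trans _ N1).
(* 64 / alpha is the margin that [oracle_power] asks for: 4 / alpha for BH at
   level alpha / 2, times 16 for the two quarters lost on |S| and on the count *)
have mean : 64 / alpha * (N * normal_tail X) <= N * freq1 M * q.
  have := ler_wpM2l (ltW N0) power.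
  have -> : N * (128 / alpha * normal_tail X) = 2 * (64 / alpha * (N * normal_tail X)).
    by ring.
  have -> : N * (2 * (freq1 M * q)) = 2 * (N * freq1 M * q) by ring.
  by rewrite ler_pM2l.
have meanw : 16 * (c4 * alpha^-1 * w) <= N * freq1 M * q.
  apply: le_trans mean.
  have -> : 16 * (c4 * alpha^-1 * w) = 64 / alpha * (kappa * w) by rewrite /c4; ring.
  by rewrite ler_wpM2l// divr_ge0// ltW.
have Np0 : 0 <= N * freq1 M by rewrite mulr_ge0// ltW.
have few : expR (- (N * freq1 M / 4)) <= 40^-1.
  apply: small; have : N * freq1 M * q <= N * freq1 M by rewrite ler_piMr.
  by move: meanw cwa (mulr_ge0 (ltW c40) w0); lra.
have [P [S [hn np H1S Mg [S1 S2 silent]]]] :=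
  silent_alternative k10 k12 k2n Np1 Np2 few mrej fdr.
have Sq : N * freq1 M * q / 16 <= #|S|%:R * q / 4.
  have := ler_wpM2r q0 S1; lra.
exists P; split=> //.
- by rewrite /n1 H1S.
- have mZ (D : set {set 'I_n}) : measurable [set y | D (rej y)].
    exact: measurable_finite_preimage.
  apply: (@le_trans _ _ (P [set y | rej y = finset.set0])).
    by rewrite -(probability_fineK P (mrej finset.set0)) lee_fin.
  apply: le_measure; rewrite ?inE//.
  - exact: (mZ (fun U => #|U :&: H1 P| = 0%N)).
  - by move=> y /= ->; rewrite finset.set0I cards0.
- apply: (oracle_power n0 ah0 X4 np H1S Mg); apply: le_trans Sq.
  + have -> : N * (2 * normal_tail X) / (alpha / 2) =
        64 / alpha * (N * normal_tail X) / 16 by field; rewrite gt_eqF.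
    by rewrite ler_pM2r ?invr_gt0.
  + by move: meanw; lra.
Qed.
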